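(* Let $q\ge 2$ be a prime power, let $g\in\mathbb{F}_q[x]$ with $\delta=\deg g\ge 1$, and let $n\ge 1$. Let $\widetilde{R}(n,g,q)$ be the number of (not necessarily monic) polynomials $f\in\mathbb{F}_q[x]$ of degree $n$ that can be written as $f=h+g^k$, where $h$ is a (not necessarily monic) irreducible polynomial of degree $n$ in $\mathbb{F}_q[x]$ and $k$ is a nonnegative integer, and put $\widetilde{r}(n,g,q)=\widetilde{R}(n,g,q)/((q-1)q^n)$. Then $$\frac{1+\delta/n}{\delta}\ \ge\ \widetilde{r}(n,g,q)\ >\ \frac{(1-2q^{-n/2})^2\,(1+\delta/n)^{-1}}{\delta+8\,\frac{q}{q-1}\left(1+e^\gamma\min\left\{5\sqrt{\delta/q},\ \frac{\log 6\delta}{\log q}\right\}\right)},$$ where $\gamma$ is Euler's constant.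
   Context: $\mathbb{F}_q$ denotes the finite field with $q$ elements. The bounds hold uniformly in $g$, $n\ge1$, $\delta\ge1$, $q\ge2$. *)

(* Defs.v *)
From HB Require Import structures.
From mathcomp Require Import all_boot all_order all_algebra all_field.
From mathcomp Require Import all_classical all_reals all_analysis.
Set Implicit Arguments. Unset Strict Implicit. Unset Printing Implicit Defensive.
Import Order.TTheory GRing.Theory Num.Theory.
Local Open Scope ring_scope.

Definition euler_gamma (R : realType) : R :=
  limn (fun m : nat => \sum_(1 <= k < m.+1) (k%:R : R)^-1 - ln (m%:R : R)).

Definition poly_of_coefs (F : fieldType) (n : nat) (c : {ffun 'I_n.+1 -> F})
  : {poly F} := \poly_(i < n.+1) c (inord i).

Definition shifted_irr (F : fieldType) (n : nat) (g f : {poly F}) : Prop :=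
  (size f = n.+1)%N /\
  exists (h : {poly F}) (k : nat),
    (size h = n.+1)%N /\ irreducible_poly h /\ f = h + g ^+ k.

(* R~(n,g,q): number of (not necessarily monic) degree-n polynomials f over F
   with f = h + g^k as above.  Degree-n polynomials are counted through their
   coefficient vectors (c_0,...,c_n), a bijection. *)
Definition Rtilde (F : finFieldType) (n : nat) (g : {poly F}) : nat :=
  #|[set c : {ffun 'I_n.+1 -> F} | `[< shifted_irr n g (poly_of_coefs c) >] ]|.

Definition rtilde (R : realType) (F : finFieldType) (n : nat) (g : {poly F}) : R :=
  (Rtilde n g)%:R / ((#|F|%:R - 1) * (#|F|%:R) ^+ n).

(* Main.v *)
(** Let r(f) be the number of k < ceil(n/delta) for which f - g^k is irreducible of
degree n.  By Cauchy-Schwarz the number of f with r(f) > 0 is at least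
(sum r)^2 / sum r^2.  The first moment is given by the prime polynomial theorem.
The second moment counts pairs of irreducible polynomials whose difference is
a = g^k - g^l, which the Selberg sieve bounds by
8 (q-1) q^n / ((n+1)(n+3)) times prod_{p | a} (1 - 1/|p|)^-1: residues modulo any
polynomial of degree at most n are exactly equidistributed, so the sieve has no
error term.

A prime p dividing both g (g^i - 1) and g (g^j - 1) also divides g (g^(i-j) - 1).
Expanding the Euler factors over sets of primes, the average of
prod_{p | g (g^j - 1)} (1 - 1/|p|)^-1 over j <= k is therefore at most a weighted
average, with weights 1/(x(x+1)), of the Euler factors of
g (g - 1) prod_{2 <= i <= x} (1 + g + ... + g^(i-1)), of degree
delta (2 + x(x-1)/2).  Finally an Euler factor of a polynomial of degree D is at
most q/(q-1) (1 + e^gamma log_q D), since it is largest when the polynomial is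
the product of all primes of small degree. *)
Require Import Defs.
From HB Require Import structures.
From mathcomp Require Import all_boot all_order all_algebra all_field.
From mathcomp Require Import zify ring lra.
Set Implicit Arguments. Unset Strict Implicit. Unset Printing Implicit Defensive.
Import Order.TTheory GRing.Theory Num.Theory.
Local Open Scope ring_scope.

(** * Irreducible polynomials and equidistribution *)

(** The obstacle is that g^j - 1 has degree growing with j: bounding each twin count by the largest
    Euler factor of its own degree would bring in n. Averaging over j avoids this, because the j at
    which given primes all divide g (g^j - 1) lie among the multiples of the least of them, and
    large j are then rare. The constant 8 comes from a sieve of level n/2: two sieve forms of degree
    at most n/2 fit into n free coefficients, and Selberg's sum is bounded below, without
    asymptotics, by comparison with the number of pairs (i, j) with i + j <= n/2. Both terms of the
    minimum come from one estimate of Euler factors, a knapsack problem with the degree as resource.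
    It is linear up to degree q and logarithmic beyond; gamma enters through the harmonic sum over
    the degrees of the primes used. The term 5 sqrt(delta/q) uses the linear range for small x and
    the logarithmic one afterwards. The number 6 absorbs the degrees 2, 3, 5 (times delta) at x = 1,
    2, 3 and the tail from x = 4. *)

Section Factors.
Variable F : finFieldType.
Implicit Types p a b : {poly F}.

Definition mirr p := irreducibleb p && (p \is monic).

Lemma mirr_irr p : mirr p -> irreducible_poly p.
Proof. by case/andP=> /irreducibleP. Qed.

Lemma mirr_monic p : mirr p -> p \is monic.
Proof. by case/andP. Qed.

Lemma mirr_size p : mirr p -> (1 < size p)%N.
Proof. by move/mirr_irr=> [[]]. Qed.

Lemma mirr_neq0 p : mirr p -> p != 0.
Proof. by move/mirr_monic/monic_neq0. Qed.

Lemma irr_dvdM p a b : irreducible_poly p -> (p %| a * b) = (p %| a) || (p %| b).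
Proof.
move=> ip; have := irreducible_poly_coprime a ip.
case: (boolP (p %| a)) => [pa _|_ c] /=; first exact: dvdp_mulr.
by rewrite Gauss_dvdpr.
Qed.

Lemma irr_dvdX p a k : irreducible_poly p -> p %| a ^+ k -> p %| a.
Proof.
move=> ip; elim: k => [|k IH]; last by rewrite exprS irr_dvdM // => /orP[].
rewrite expr0 => /(dvdp_leq (oner_neq0 _)); rewrite size_poly1.
by rewrite leqNgt ip.1.
Qed.

Lemma mirr_dvd_eq p r : mirr p -> mirr r -> p %| r -> p = r.
Proof.
move=> hp hr pr; apply/eqP.
rewrite -eqp_monic ?mirr_monic //; apply: (mirr_irr hr).2 => //.
by rewrite neq_ltn mirr_size ?orbT.
Qed.

Lemma mirr_coprime p r : mirr p -> mirr r -> p != r -> coprimep p r.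
Proof.
move=> hp hr npr; rewrite irreducible_poly_coprime; last exact: mirr_irr.
by apply: contra npr => /(mirr_dvd_eq hp hr) ->.
Qed.

Lemma exists_mirr_factor a : (1 < size a)%N -> exists2 p, mirr p & p %| a.
Proof.
move: {2}(size a) (leqnn (size a)) => m; elim: m a => [|m IH] a sm sa.
  by move: sa; rewrite ltnNge (leq_trans sm).
have [ia|] := boolP (irreducibleb a); last first.
  rewrite /irreducibleb sa negb_forall => /existsP[/= b].
  rewrite negb_imply -ltnNge -Pdiv.Idomain.dvdpE => /andP[ba sb].
  move: (polyn b) (size_npoly b) ba sb => {}b lb ba sb.
  have [||p hp pb] := IH b _ _ => //.
    by rewrite -ltnS (leq_trans _ sm) // -(prednK (ltnW sa)) ltnS.
  by exists p => //; apply: dvdp_trans pb ba.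
have a0 : a != 0 by rewrite -size_poly_gt0 ltnW.
have l0 : lead_coef a != 0 by rewrite lead_coef_eq0.
have e : (lead_coef a)^-1 *: a %= a by apply: eqp_scale; rewrite invr_eq0.
exists ((lead_coef a)^-1 *: a); last by rewrite (eqp_dvdl _ e).
apply/andP; split; last by rewrite monicE lead_coefZ mulVf.
move/irreducibleP: ia => ia; apply/irreducibleP.
split; first by rewrite (eqp_size e).
move=> b sb; rewrite (eqp_dvdr _ e) => ba.
by rewrite (eqp_trans (ia.2 b sb ba)) // eqp_sym.
Qed.

Lemma size_rVpoly n (v : 'rV[F]_n) : (size (rVpoly v) <= n)%N.
Proof. exact: size_poly. Qed.

Lemma size_XnDr n (v : 'rV[F]_n) : size ('X^n + rVpoly v) = n.+1.
Proof. by rewrite size_polyDl size_polyXn // ltnS size_rVpoly. Qed.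

Lemma monic_XnDr n (v : 'rV[F]_n) : 'X^n + rVpoly v \is monic.
Proof.
by rewrite monicE lead_coefDl ?lead_coefXn // size_polyXn ltnS size_rVpoly.
Qed.

Lemma monic_XnDrP n (m : {poly F}) : m \is monic -> size m = n.+1 ->
  exists v : 'rV[F]_n, m = 'X^n + rVpoly v.
Proof.
move=> mm sm; exists (poly_rV (m - 'X^n)); rewrite poly_rV_K; first by rewrite addrC subrK.
have := size_polyD m (- 'X^n); rewrite size_polyN size_polyXn sm maxnn => le.
rewrite -ltnS ltn_neqAle le andbT; apply/eqP => e.
have /eqP : lead_coef (m - 'X^n) = 0.
  rewrite lead_coefE e /= coefB coefXn eqxx.
  by move/monicP: mm; rewrite /lead_coef sm /= => ->; rewrite subrr.
by rewrite lead_coef_eq0 -size_poly_eq0 e.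
Qed.

End Factors.

Section Equidistribution.
Variables (F : finFieldType) (R : realFieldType).
Implicit Types p a b h : {poly F}.
Local Notation q := (#|F|%:R : R).

Lemma qgt1 : (1 < #|F|)%N.
Proof. exact: finNzRing_gt1. Qed.

Lemma qR_gt1 : 1 < q.
Proof. by rewrite ltr1n qgt1. Qed.

Lemma qR_gt0 : 0 < q.
Proof. exact: lt_trans ltr01 qR_gt1. Qed.

Lemma card_rV n : #|{: 'rV[F]_n}| = (#|F| ^ n)%N.
Proof. by rewrite card_mx mul1n. Qed.

Definition periodic (Q : {poly F}) (u : {poly F} -> R) :=
  forall h t, u (h + Q * t) = u h.

Lemma size_mul_le p a (n d : nat) : size p = d.+1 -> (size a <= n - d)%N ->
  (d <= n)%N -> (size (p * a)%R <= n)%N.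
Proof.
move=> sp sa dn; apply: leq_trans (size_polyMleq p a) _; rewrite sp addSn /=.
by rewrite -(subnKC dn) leq_add2l.
Qed.

(* Translating by Q * t, deg t < deg p, fixes psi and runs u through all residues mod p. *)
Lemma independence p (Q : {poly F}) (psi u : {poly F} -> R) h0 n d e :
  size p = d.+1 -> size Q = e.+1 -> coprimep p Q -> (d + e <= n)%N ->
  periodic Q psi -> periodic p u ->
  \sum_(v : 'rV[F]_n) psi (h0 + rVpoly v) * u (h0 + rVpoly v) =
  (\sum_(v : 'rV[F]_n) psi (h0 + rVpoly v)) *
    ((\sum_(r : 'rV[F]_d) u (rVpoly r)) / q ^+ d).
Proof.
move=> sp sQ cpQ le pp pu.
have p0 : p != 0 by rewrite -size_poly_gt0 sp.
rewrite mulrA; apply: (canRL (mulfK _)); first by rewrite expf_neq0 ?gt_eqF ?qR_gt0.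
have shift (t : 'rV[F]_d) : \sum_(v : 'rV[F]_n) psi (h0 + rVpoly v) * u (h0 + rVpoly v)
   = \sum_(v : 'rV[F]_n) psi (h0 + rVpoly v) * u (h0 + rVpoly v + Q * rVpoly t).
  rewrite (reindex_inj (addIr (poly_rV (Q * rVpoly t)))) /=; apply: eq_bigr => v _.
  rewrite linearD /= poly_rV_K; last first.
    apply: (size_mul_le sQ); last by move: le; clear; lia.
    by apply: leq_trans (size_rVpoly _) _; move: le; clear; lia.
  by rewrite addrA pp.
have -> : q ^+ d = \sum_(t : 'rV[F]_d) 1.
  by rewrite sumr_const card_rV natrX.
rewrite mulr_sumr (eq_bigr _ (fun t _ => etrans (mulr1 _) (shift t))) exchange_big /=.
rewrite mulr_suml; apply: eq_bigr => v _; rewrite -mulr_sumr; congr (_ * _).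
set h := h0 + _.
pose f (t : 'rV[F]_d) : 'rV[F]_d := poly_rV ((h + Q * rVpoly t) %% p).
have fE t : rVpoly (f t) = (h + Q * rVpoly t) %% p.
  by rewrite poly_rV_K // -ltnS -sp ltn_modp.
have finj : injective f.
  move=> t1 t2 /(congr1 rVpoly); rewrite !fE => e12.
  have : p %| Q * (rVpoly t1 - rVpoly t2).
    rewrite mulrBr (_ : _ - _ = (h + Q * rVpoly t1) - (h + Q * rVpoly t2)); last first.
      by rewrite opprD addrACA subrr add0r.
    by rewrite /dvdp modpD modpN e12 subrr.
  rewrite Gauss_dvdpr // -linearB /= => dv.
  have z : rVpoly (t1 - t2) = 0.
    apply/eqP; apply: contraT => nz; have := dvdp_leq nz dv.
    by rewrite sp leqNgt ltnS size_rVpoly.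
  by apply/eqP; rewrite -subr_eq0; apply/eqP/(can_inj rVpolyK); rewrite z linear0.
rewrite [RHS](reindex_inj finj) /=; apply: eq_bigr => t _.
rewrite fE -[RHS](pu _ ((h + Q * rVpoly t) %/ p)) [in RHS]addrC (mulrC p).
by rewrite -divp_eq.
Qed.

Lemma periodic1 c : periodic 1 (fun=> c).
Proof. by []. Qed.

Lemma equidistribution p (u : {poly F} -> R) h0 n d :
  size p = d.+1 -> (d <= n)%N -> periodic p u ->
  \sum_(v : 'rV[F]_n) u (h0 + rVpoly v) =
  q ^+ n * ((\sum_(r : 'rV[F]_d) u (rVpoly r)) / q ^+ d).
Proof.
move=> sp dn pu.
have := @independence p 1 (fun=> 1) u h0 n d 0 sp (size_poly1 _) (coprimep1 _) _ (periodic1 1) pu.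
rewrite addn0 => /(_ dn); under eq_bigr do rewrite mul1r.
by rewrite sumr_const card_rV natrX => ->.
Qed.

Lemma periodicM Q1 Q2 (u1 u2 : {poly F} -> R) :
  periodic Q1 u1 -> periodic Q2 u2 -> periodic (Q1 * Q2) (fun h => u1 h * u2 h).
Proof. by move=> p1 p2 h t /=; rewrite -mulrA p1 mulrCA p2. Qed.

Lemma periodic_dvd Q (b : {poly F}) : periodic Q (fun h => (Q %| h + b)%R%:R).
Proof. by move=> h t; rewrite addrAC dvdp_addl // dvdp_mulr. Qed.

Lemma count_residue p b h0 n d : size p = d.+1 -> (d <= n)%N ->
  \sum_(v : 'rV[F]_n) ((p %| h0 + rVpoly v + b)%R%:R : R) = q ^+ n / q ^+ d.
Proof.
move=> sp dn; have p0 : p != 0 by rewrite -size_poly_gt0 sp.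
rewrite (equidistribution h0 sp dn (periodic_dvd _ b)).
rewrite (bigD1 (poly_rV ((- b) %% p))) //= poly_rV_K; last first.
  by rewrite -ltnS -sp ltn_modp.
rewrite big1 ?addr0 => [|r nr]; last first.
  suff -> : p %| rVpoly r + b = false by [].
  apply: contraNF nr => dv; apply/eqP/(can_inj rVpolyK).
  rewrite poly_rV_K; last by rewrite -ltnS -sp ltn_modp.
  have : (rVpoly r - (- b)) %% p = 0 by apply/eqP; rewrite opprK.
  rewrite modpD modpN => /subr0_eq <-.
  by rewrite modp_small // sp ltnS size_rVpoly.
have -> : p %| (- b) %% p + b.
  by rewrite /dvdp modpD [X in X + _]modp_small ?ltn_modp // -modpD addNr mod0p.
by rewrite mul1r.
Qed.

End Equidistribution.

(** * Primes listed by degree, and degrees as sums over prime powers *)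

Section PrimeCounting.
Variable (F : finFieldType).
Implicit Types p a b m : {poly F}.

(** Primes are kept in sequences because the sieve, the smooth counts and the expansion of Euler
    products all go by induction over a list of primes. *)
Definition irr d : seq {poly F} :=
  [seq p <- [seq 'X^d + rVpoly v | v <- enum {: 'rV[F]_d}] | irreducibleb p].

Lemma mem_irr d p : (p \in irr d) = mirr p && (size p == d.+1).
Proof.
rewrite mem_filter /mirr -andbA; case ip: (irreducibleb p) => //=.
apply/mapP/andP => [[v _ ->]|[mp /eqP sp]].
  by rewrite monic_XnDr size_XnDr.
by have [v ->] := monic_XnDrP mp sp; exists v; rewrite // mem_enum.
Qed.

Lemma uniq_irr d : uniq (irr d).
Proof.
rewrite filter_uniq // map_inj_uniq ?enum_uniq // => u v /addrI.
exact: (can_inj rVpolyK).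
Qed.

Fixpoint irrs M : seq {poly F} := if M is M'.+1 then irrs M' ++ irr M else [::].

Lemma mem_irrs M p : (p \in irrs M) = mirr p && (size p <= M.+1)%N.
Proof.
elim: M => [|M IH] /=.
  by rewrite in_nil; apply/esym/negP => /andP[/mirr_size]; rewrite ltnNge => /negP.
by rewrite mem_cat IH mem_irr -andb_orr [in RHS]leq_eqVlt ltnS orbC.
Qed.

Lemma uniq_irrs M : uniq (irrs M).
Proof.
elim: M => //= M IH; rewrite cat_uniq IH uniq_irr /= andbT.
apply/hasPn => p; rewrite mem_irr mem_irrs => /andP[-> /eqP ->].
by rewrite ltnn.
Qed.

Lemma mirr_irrs M p : p \in irrs M -> mirr p.
Proof. by rewrite mem_irrs => /andP[]. Qed.

Lemma big_irrs (V : nmodType) M (f : {poly F} -> V) :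
  \sum_(p <- irrs M) f p = \sum_(1 <= d < M.+1) \sum_(p <- irr d) f p.
Proof.
elim: M => [|M IH]; first by rewrite big_nil big_geq.
by rewrite big_cat IH [RHS]big_nat_recr.
Qed.

Definition dg p := (size p).-1.

Lemma dg_gt0 p : mirr p -> (0 < dg p)%N.
Proof. by move/mirr_size; rewrite /dg; case: size => // -[]. Qed.

Lemma size_dg p : p != 0 -> size p = (dg p).+1.
Proof. by move=> p0; rewrite prednK // size_poly_gt0. Qed.

Lemma dgM p a : p != 0 -> a != 0 -> dg (p * a) = (dg p + dg a)%N.
Proof. by move=> p0 a0; rewrite /dg size_mul // (size_dg p0) (size_dg a0) addSn addnS. Qed.

Lemma dgX p j : dg (p ^+ j) = (dg p * j)%N.
Proof. by rewrite /dg size_exp. Qed.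

Lemma dvdp_dg p a : a != 0 -> p %| a -> (dg p <= dg a)%N.
Proof. by move=> a0 pa; rewrite /dg -!subn1 leq_sub2r // dvdp_leq. Qed.

Lemma dg_irr d p : p \in irr d -> dg p = d.
Proof. by rewrite mem_irr /dg => /andP[_ /eqP ->]. Qed.

Lemma ndvdX p j a : a != 0 -> (dg a < dg p * j)%N -> (p ^+ j %| a) = false.
Proof.
by move=> a0 lt; apply/negP => /(dvdp_dg a0); rewrite dgX leqNgt lt.
Qed.

(** The p-adic valuation, as soon as [N] bounds it, written as a sum of divisibility indicators so
    that it can be averaged over [a]. *)
Definition valp N p a : nat := \sum_(1 <= j < N.+1) (p ^+ j %| a)%R.

(** Unique factorization seen through degrees, the analogue of log n = sum of Lambda(d) over d | n.
    Splitting off a prime p0 lowers its valuation by one and leaves the others unchanged. *)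
Lemma dg_valp n a : a != 0 -> (dg a <= n)%N ->
  dg a = (\sum_(p <- irrs n) dg p * valp n p a)%N.
Proof.
move: {2}(dg a) (leqnn (dg a)) => k; elim: k a => [|k IH] a ak a0 an.
  rewrite big1_seq; first by move: ak; lia.
  move=> p /= /mirr_irrs hp; rewrite /valp big1_seq ?muln0 // => j.
  rewrite mem_index_iota /= => /andP[j0 _]; rewrite ndvdX //.
  by apply: leq_ltn_trans ak _; rewrite muln_gt0 dg_gt0.
have [da|da] := eqVneq (dg a) 0%N; first last.
  have [|p0 hp0 /dvdpP[b eab]] := @exists_mirr_factor _ a.
    by move: da; rewrite /dg; lia.
  have b0 : b != 0 by apply: contraNneq a0 => b0; rewrite eab b0 mul0r.
  have da' : dg a = (dg b + dg p0)%N by rewrite eab dgM // mirr_neq0.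
  have dp0 := dg_gt0 hp0.
  have p0in : p0 \in irrs n.
    by rewrite mem_irrs hp0 /= (size_dg (mirr_neq0 hp0)); move: da' an; lia.
  rewrite da' (IH b) //; [|by move: da' ak dp0; lia|by move: da' an; lia].
  rewrite (bigD1_seq p0) ?uniq_irrs //= [in RHS](bigD1_seq p0) ?uniq_irrs //=.
  rewrite addnAC; congr addn.
    rewrite -[X in (_ + X)%N]muln1 -mulnDr addn1; congr muln.
    have n0 : (0 < n)%N by move: da' an dp0; clear; lia.
    rewrite /valp [RHS]big_nat_recl //= [X in nat_of_bool X](_ : _ = true); last first.
      by rewrite eab dvdp_mull // dvdpp.
    rewrite add1n; congr S.
    (* After the index shift one term too many remains on the left; p0^n does not divide b, since dg
       b < n. *)
    rewrite big_nat_recr //=.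
    rewrite [X in (_ + X)%N](_ : _ = 0%N) ?addn0.
      apply: eq_big_nat => j _; congr nat_of_bool.
      by rewrite eab exprSr dvdp_mul2r ?mirr_neq0.
    rewrite ndvdX //; move: da' an dp0.
    by move: (dg a) (dg b) (dg p0); clear; nia.
  rewrite big_seq_cond [in RHS]big_seq_cond; apply: eq_bigr => p /andP[/mirr_irrs hp np].
  congr muln; apply: eq_big_nat => j _; congr nat_of_bool.
  by rewrite eab mulrC Gauss_dvdpr // coprimep_expl // mirr_coprime.
rewrite da; apply/esym/big1_seq => p /= /mirr_irrs hp; rewrite /valp big1_seq ?muln0 // => j.
rewrite mem_index_iota /= => /andP[j0 _]; rewrite ndvdX //.
by rewrite da muln_gt0 dg_gt0.
Qed.

End PrimeCounting.

Lemma sum_multiples (V : nmodType) (f : nat -> V) d n : (0 < d)%N ->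
  \sum_(1 <= j < n.+1) (if (d * j <= n)%N then f (d * j)%N else 0) =
  \sum_(1 <= r < n.+1) (if (d %| r)%N then f r else 0).
Proof.
move=> d0.
have -> : \sum_(1 <= j < n.+1) (if (d * j <= n)%N then f (d * j)%N else 0) =
    \sum_(1 <= j < n.+1) \sum_(1 <= r < n.+1) (if r == (d * j)%N then f r else 0).
  apply: eq_big_nat => j /andP[j0 jn]; case: ifP => le.
    rewrite (bigD1_seq (d * j)%N) ?iota_uniq ?mem_index_iota ?ltnS ?le ?muln_gt0 ?d0 ?j0 //=.
    rewrite eqxx big1 ?addr0 // => r /negPf -> //.
  rewrite big1_seq // => r /=; rewrite mem_index_iota /= => /andP[_ rn].
  by case: eqP => // e; move: rn; rewrite ltnS e le.
rewrite exchange_big /=; apply: eq_big_nat => r /andP[r0 rn].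
case: ifP => [/dvdnP[j e]|nd]; last first.
  by apply: big1 => j _; case: eqP => // e; move: nd; rewrite e dvdn_mulr.
have j0 : (0 < j)%N by case: j e r0 => // ->.
have jn : (j < n.+1)%N by apply: leq_ltn_trans rn; rewrite e leq_pmulr.
rewrite (bigD1_seq j) ?iota_uniq ?mem_index_iota ?j0 //= e mulnC eqxx.
rewrite big1 ?addr0 // => i ni; case: eqP => // /eqP.
by rewrite eqn_pmul2l // eq_sym (negPf ni).
Qed.

(** * The prime polynomial theorem *)

Section Gauss.
Variable F : finFieldType.
Local Notation q := (#|F|%:R : rat).

Definition primepi d := size (irr F d).
Definition divisor_sum r := (\sum_(1 <= d < r.+1 | (d %| r)%N) d * primepi d)%N.

Lemma sum_irr_const (d : nat) (V : nmodType) (f : {poly F} -> V) c :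
  (forall p, p \in irr F d -> f p = c) -> \sum_(p <- irr F d) f p = c *+ primepi d.
Proof.
move=> h; rewrite big_seq (eq_bigr (fun=> c)) // -big_seq big_const_seq.
by rewrite count_predT iter_addr_0.
Qed.

(** Average [dg_valp] over the monic polynomials of degree n: p^j divides a proportion |p|^(-j) of
    them if j dg p <= n, and none otherwise. Grouping by r = j dg p gives the series, and the
    difference of consecutive n isolates [divisor_sum n]. *)
Lemma divisor_sum_series n : n%:R = \sum_(1 <= r < n.+1) (divisor_sum r)%:R / q ^+ r.
Proof.
have qn0 : q ^+ n != 0 by rewrite expf_neq0 ?gt_eqF ?qR_gt0.
apply: (mulIf qn0).
have dX (v : 'rV[F]_n) : dg ('X^n + rVpoly v) = n by rewrite /dg size_XnDr.
have X0 (v : 'rV[F]_n) : 'X^n + rVpoly v != 0 by rewrite monic_neq0 ?monic_XnDr.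
transitivity (\sum_(v : 'rV[F]_n) \sum_(p <- irrs F n) \sum_(1 <= j < n.+1)
    (dg p)%:R * ((p ^+ j %| 'X^n + rVpoly v + 0)%R%:R : rat)).
  rewrite (eq_bigr (fun=> n%:R)) => [|v _].
    by rewrite sumr_const card_rV -natrX mulr_natr.
  rewrite -[in RHS](dX v) (@dg_valp _ n) ?X0 ?dX // natr_sum; apply: eq_bigr => p _.
  by rewrite /valp natrM natr_sum mulr_sumr; apply: eq_bigr => j _; rewrite addr0.
rewrite exchange_big /=.
transitivity (\sum_(p <- irrs F n) \sum_(1 <= j < n.+1)
   (if (dg p * j <= n)%N then (dg p)%:R * (q ^+ n / q ^+ (dg p * j)) else 0)).
  rewrite big_seq [RHS]big_seq; apply: eq_bigr => p /mirr_irrs hp.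
  rewrite exchange_big /=; apply: eq_big_nat => j _.
  rewrite -mulr_sumr; case: leqP => le.
    rewrite (@count_residue F _ _ _ _ _ (dg p * j)) //.
    by rewrite -dgX -size_dg // expf_neq0 // mirr_neq0.
  rewrite big1 ?mulr0 // => v _; rewrite addr0 ndvdX ?X0 ?dX //.
rewrite (big_irrs n); transitivity (\sum_(1 <= d < n.+1) \sum_(1 <= r < n.+1)
    (if (d %| r)%N then (d * primepi d)%:R * (q ^+ n / q ^+ r) else 0)).
  apply: eq_big_nat => d /andP[d0 _].
  rewrite (@sum_irr_const _ _ _ (\sum_(1 <= j < n.+1)
   (if (d * j <= n)%N then d%:R * (q ^+ n / q ^+ (d * j)) else 0))); last first.
    by move=> p /dg_irr ->.
  rewrite (sum_multiples (fun r => d%:R * (q ^+ n / q ^+ r))) // -sumrMnl.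
  apply: eq_bigr => r _; case: ifP => _; last by rewrite mul0rn.
  by rewrite -mulrnAl natrM mulr_natr.
rewrite exchange_big mulr_suml; apply: eq_big_nat => r /andP[r0 rn].
rewrite -mulrA (mulrC _^-1) /divisor_sum natr_sum mulr_suml.
rewrite (big_cat_nat (n := r.+1)) //=.
rewrite [X in _ + X]big1_seq ?addr0; last first.
  move=> d /=; rewrite mem_index_iota /= => /andP[rd _]; case: ifP => // dr.
  by have := dvdn_leq r0 dr; rewrite leqNgt rd.
by rewrite [in RHS]big_mkcond; apply: eq_bigr => d _; case: ifP => // _; rewrite mul0r.
Qed.

Lemma divisor_sumE n : (0 < n)%N -> divisor_sum n = (#|F| ^ n)%N.
Proof.
case: n => // n _; have := divisor_sum_series n.+1.
rewrite big_nat_recr //= -divisor_sum_series -natr1 => /addrI.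
move/(congr1 (fun x => x * q ^+ n.+1)).
rewrite divfK ?expf_neq0 ?gt_eqF ?qR_gt0 // mul1r -natrX => /eqP.
by rewrite eqr_nat => /eqP.
Qed.

Lemma primepi1 : primepi 1 = #|F|.
Proof.
have := @divisor_sumE 1 isT; rewrite expn1 /divisor_sum big_mkcond big_nat1 /= mul1n //.
Qed.

Lemma divisor_sumD1 n : (0 < n)%N -> divisor_sum n =
  (n * primepi n + \sum_(1 <= d < n | (d %| n)%N) d * primepi d)%N.
Proof.
by move=> n0; rewrite /divisor_sum big_mkcond big_nat_recr //= dvdnn -big_mkcond addnC.
Qed.

Lemma primepi_le n : (0 < n)%N -> (n * primepi n <= #|F| ^ n)%N.
Proof. by move=> n0; rewrite -divisor_sumE // divisor_sumD1 // leq_addr. Qed.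

(** The divisor 1 already contributes q to the divisor sum. Strictness is what permits the cap q^d -
    1 in [degcap]. *)
Lemma primepi_lt n : (1 < n)%N -> (n * primepi n < #|F| ^ n)%N.
Proof.
move=> n1; rewrite -divisor_sumE ?(ltnW n1) // divisor_sumD1 ?(ltnW n1) // -addn1 leq_add2l.
rewrite big_mkcond big_ltn //= dvd1n primepi1 mul1n addn_gt0.
by rewrite (ltnW (qgt1 F)).
Qed.

(** Proper divisors of n are at most n/2, and each contributes at most q^d. *)
Lemma primepi_ge n : (1 < n)%N ->
  (#|F| ^ n <= n * primepi n + \sum_(1 <= d < n./2.+1) #|F| ^ d)%N.
Proof.
move=> n1; have n0 := ltnW n1; rewrite -divisor_sumE // divisor_sumD1 // leq_add2l.
rewrite (big_cat_nat (n := n./2.+1)) //=; last by lia.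
rewrite [X in (_ + X <= _)%N]big1_seq ?addn0; last first.
  move=> d /=; rewrite mem_index_iota => /andP[/dvdnP[k e] /andP[rd dn]].
  case: k e => [|[|k]] e; move: e dn n0 rd; [lia|lia|].
  by rewrite -divn2 => ->; nia.
rewrite big_mkcond /= big_nat [leqRHS]big_nat; apply: leq_sum => d /andP[d0 _].
by case: ifP => // _; apply: primepi_le.
Qed.

(** Source of the term 2 q^(-n/2) in the final bound; the strict [geom_lt] instead shows that primes
    of every degree exist, including q = 2. *)
Lemma geom_le m : (\sum_(1 <= d < m.+1) #|F| ^ d <= 2 * #|F| ^ m)%N.
Proof.
elim: m => [|m IH]; first by rewrite big_geq.
rewrite big_nat_recr //= (leq_trans (leq_add IH (leqnn _))) // expnS.
have := qgt1 F; have : (0 < #|F| ^ m)%N by rewrite expn_gt0 (ltnW (qgt1 F)).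
by move: (#|F| ^ m)%N #|F|; clear; nia.
Qed.

Lemma geom_lt m : (\sum_(1 <= d < m.+1) #|F| ^ d < #|F| ^ m.+1)%N.
Proof.
elim: m => [|m IH]; first by rewrite big_geq // expn1 (ltnW (qgt1 F)).
rewrite big_nat_recr //= [X in (_ < X)%N]expnS.
have := qgt1 F; move: IH; set S := bigop _ _ _.
by move: S (#|F| ^ m.+1)%N #|F|; clear; nia.
Qed.

Lemma primepi_gt0 n : (0 < n)%N -> (0 < primepi n)%N.
Proof.
case: n => [//|[|n]] _; first by rewrite primepi1 (ltnW (qgt1 F)).
have := @primepi_ge n.+2 isT; have := geom_lt n.+2./2.
have : (#|F| ^ (n.+2./2).+1 <= #|F| ^ n.+2)%N by rewrite leq_exp2l ?qgt1 //; lia.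
case: (primepi n.+2) => //; rewrite muln0; lia.
Qed.

End Gauss.

(** * The Selberg sieve *)

Section Sieve.
Variables (F : finFieldType) (R : realFieldType) (b : {poly F}).
Implicit Types (p h : {poly F}) (L : seq {poly F}).
Local Notation q := (#|F|%:R : R).

Definition pnorm p : R := q ^+ dg p.

Lemma pnorm_gt0 p : 0 < pnorm p.
Proof. by rewrite exprn_gt0 // qR_gt0. Qed.

Lemma pnorm_gt1 p : mirr p -> 1 < pnorm p.
Proof. by move=> hp; rewrite exprn_egt1 ?qR_gt1 // -lt0n dg_gt0. Qed.

(** The residue classes 0 and -b modulo p, to be avoided when h and h + b are irreducible of degree
    larger than dg p. [omega p] is the number of these classes, [sieve_wt p] the local weight of
    Selberg's sieve. *)
Definition sieved p h := (p %| h) || (p %| h + b).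
Definition omega p : R := if p %| b then 1 else 2.
Definition sieve_wt p : R := omega p / (pnorm p - omega p).
(* Takes the value sieve_wt p on unsieved h and has mean 0, so that products over
   distinct sets of primes are orthogonal. *)
Definition sieve_dual p h : R := if sieved p h then -1 else sieve_wt p.

Lemma omega_gt0 p : 0 < omega p.
Proof. by rewrite /omega; case: ifP. Qed.

Lemma sievedE p h : (sieved p h)%:R =
  (p %| h + 0)%R%:R + (if p %| b then 0 else (p %| h + b)%R%:R) :> R.
Proof.
rewrite addr0 /sieved; case: ifP => [pb|npb].
  by rewrite dvdp_addl // orbb addr0.
case ph: (p %| h) => /=; last by rewrite add0r.
by rewrite dvdp_addr // npb addr0.
Qed.

Lemma periodic_sieved p h t : sieved p (h + p * t) = sieved p h.
Proof.
have pt : p %| p * t by rewrite dvdp_mulr.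
by rewrite /sieved addrAC !(dvdp_addl _ pt).
Qed.

Lemma periodic_sieve_dual p : periodic p (sieve_dual p).
Proof. by move=> h t; rewrite /sieve_dual periodic_sieved. Qed.

Lemma periodic_sieve_dual2 p : periodic p (fun h => sieve_dual p h ^+ 2).
Proof. by move=> h t; rewrite periodic_sieve_dual. Qed.

Lemma sum_sieved p : mirr p ->
  \sum_(r : 'rV[F]_(dg p)) ((sieved p (rVpoly r))%:R : R) = omega p.
Proof.
move=> hp; have sp := size_dg (mirr_neq0 hp).
have c (a : {poly F}) : \sum_(r : 'rV[F]_(dg p)) ((p %| rVpoly r + a)%R%:R : R) = 1.
  have := @count_residue F R p a 0 _ _ sp (leqnn _).
  by under eq_bigr do rewrite add0r; rewrite divff // gt_eqF // pnorm_gt0.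
rewrite (eq_bigr _ (fun r _ => sievedE p (rVpoly r))) big_split /= c /omega.
by case: ifP => _; rewrite ?c // big1_eq addr0.
Qed.

Lemma sum_sieve_dual p : mirr p -> omega p < pnorm p ->
  \sum_(r : 'rV[F]_(dg p)) sieve_dual p (rVpoly r) = 0.
Proof.
move=> hp lt; have nz : pnorm p - omega p != 0 by rewrite subr_eq0 gt_eqF.
rewrite (eq_bigr (fun r => sieve_wt p + (- (1 + sieve_wt p)) * (sieved p (rVpoly r))%:R)); last first.
  by move=> r _; rewrite /sieve_dual; case: sieved => /=; ring.
rewrite big_split /= sumr_const card_rV -mulr_sumr sum_sieved // -mulr_natr natrX.
rewrite -/(pnorm p) /sieve_wt; field.
exact: nz.
Qed.

Lemma sum_sieve_dual2 p : mirr p -> omega p < pnorm p ->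
  (\sum_(r : 'rV[F]_(dg p)) sieve_dual p (rVpoly r) ^+ 2) / pnorm p = sieve_wt p.
Proof.
move=> hp lt; have nz : pnorm p - omega p != 0 by rewrite subr_eq0 gt_eqF.
rewrite (eq_bigr (fun r => sieve_wt p ^+ 2 + (1 - sieve_wt p ^+ 2) * (sieved p (rVpoly r))%:R)); last first.
  by move=> r _; rewrite /sieve_dual; case: sieved => /=; ring.
rewrite big_split /= sumr_const card_rV -mulr_sumr sum_sieved // -mulr_natr natrX.
rewrite -/(pnorm p) /sieve_wt; field.
by rewrite nz gt_eqF ?pnorm_gt0.
Qed.

(** A sum over the subsets of L of total degree at most D, each giving the product of its
    [sieve_dual]; the recursion decides whether p belongs to the subset. [sieve_mass] is the same
    sum with the constants [sieve_wt], that is, Selberg's sum. *)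
Fixpoint sieve_form L D h : R :=
  if L is p :: L' then
    sieve_form L' D h + (if (dg p <= D)%N then sieve_dual p h * sieve_form L' (D - dg p)%N h else 0)
  else 1.

Fixpoint sieve_mass L D : R :=
  if L is p :: L' then
    sieve_mass L' D + (if (dg p <= D)%N then sieve_wt p * sieve_mass L' (D - dg p)%N else 0)
  else 1.

Lemma sieve_form_good L D h : all (fun p => ~~ sieved p h) L -> sieve_form L D h = sieve_mass L D.
Proof.
elim: L D => //= p L IH D /andP[gp gL]; rewrite !IH //.
by case: ifP => // _; rewrite /sieve_dual (negPf gp).
Qed.

(** Multiply out both forms at the first prime p. Cross terms vanish because [sieve_dual p] has mean
    0, and the diagonal term yields its mean square [sieve_wt p]. The factor psi carries the primes
    already treated, whose product is the modulus Q; the degree condition keeps independence exact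
    throughout. *)
Lemma orthogonality L (Q : {poly F}) psi h0 n D1 D2 :
  uniq L -> {in L, forall p, [/\ mirr p, omega p < pnorm p & coprimep p Q]} ->
  Q != 0 -> periodic Q psi -> (dg Q + D1 + D2 <= n)%N ->
  \sum_(v : 'rV[F]_n) psi (h0 + rVpoly v) *
     (sieve_form L D1 (h0 + rVpoly v) * sieve_form L D2 (h0 + rVpoly v)) =
  (\sum_(v : 'rV[F]_n) psi (h0 + rVpoly v)) * sieve_mass L (minn D1 D2).
Proof.
elim: L Q psi D1 D2 => [|p L IH] Q psi D1 D2 /=.
  by move=> _ _ _ _ _; rewrite !mulr1; apply: eq_bigr => v _; rewrite mulr1.
move=> /andP[pL uL] hL Q0 pQ le.
have [hp wp cp] := hL p (mem_head _ _).
have hL' : {in L, forall r, [/\ mirr r, omega r < pnorm r & coprimep r Q]}.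
  by move=> r rL; apply: hL; rewrite inE rL orbT.
have p0 := mirr_neq0 hp.
have QpL : {in L, forall r, [/\ mirr r, omega r < pnorm r & coprimep r (Q * p)]}.
  move=> r rL; have [hr wr cr] := hL' r rL; split=> //.
  rewrite coprimepMr cr mirr_coprime //.
  by apply: contraNneq pL => <-.
have Qp0 : Q * p != 0 by rewrite mulf_neq0.
have dQp : dg (Q * p) = (dg Q + dg p)%N by rewrite dgM.
(* The induction hypothesis is applied to psi times u with modulus Q p, after which independence of
   Q and p splits off the mean of u. *)
have ind (u : {poly F} -> R) E1 E2 : periodic p u ->
    (dg Q + dg p + E1 + E2 <= n)%N ->
    \sum_(v : 'rV[F]_n) psi (h0 + rVpoly v) * u (h0 + rVpoly v) *
     (sieve_form L E1 (h0 + rVpoly v) * sieve_form L E2 (h0 + rVpoly v)) =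
    (\sum_(v : 'rV[F]_n) psi (h0 + rVpoly v)) *
    ((\sum_(r : 'rV[F]_(dg p)) u (rVpoly r)) / pnorm p) * sieve_mass L (minn E1 E2).
  move=> pu leE; rewrite (IH _ (fun h => psi h * u h) E1 E2 uL QpL Qp0) ?dQp //; last first.
    exact: periodicM.
  congr (_ * _); apply: (independence _ _ _ cp) pQ pu; [exact: size_dg|exact: size_dg|].
  by move: leE; clear; lia.
pose H (v : 'rV[F]_n) := h0 + rVpoly v.
pose B D v := if (dg p <= D)%N then sieve_dual p (H v) * sieve_form L (D - dg p)%N (H v) else 0.
transitivity (\sum_(v : 'rV[F]_n) psi (H v) * (sieve_form L D1 (H v) * sieve_form L D2 (H v)) +
   \sum_(v : 'rV[F]_n) psi (H v) * (sieve_form L D1 (H v) * B D2 v) +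
   \sum_(v : 'rV[F]_n) psi (H v) * (B D1 v * sieve_form L D2 (H v)) +
   \sum_(v : 'rV[F]_n) psi (H v) * (B D1 v * B D2 v)).
  rewrite -!big_split /=; apply: eq_bigr => v _; rewrite -/(H v) -/(B D1 v) -/(B D2 v).
  by ring.
rewrite (IH Q) //.
have -> : \sum_(v : 'rV[F]_n) psi (H v) * (sieve_form L D1 (H v) * B D2 v) = 0.
  rewrite /B; case: (leqP (dg p) D2) => le2; last by rewrite big1 // => v _; rewrite !mulr0.
  transitivity (\sum_(v : 'rV[F]_n) psi (H v) * sieve_dual p (H v) *
     (sieve_form L D1 (H v) * sieve_form L (D2 - dg p)%N (H v))); first by apply: eq_bigr => v _; ring.
  rewrite (ind (sieve_dual p)); [|exact: periodic_sieve_dual|by move: le le2; clear; lia].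
  by rewrite sum_sieve_dual // mul0r mulr0 mul0r.
have -> : \sum_(v : 'rV[F]_n) psi (H v) * (B D1 v * sieve_form L D2 (H v)) = 0.
  rewrite /B; case: (leqP (dg p) D1) => le1; last by rewrite big1 // => v _; rewrite mul0r !mulr0.
  transitivity (\sum_(v : 'rV[F]_n) psi (H v) * sieve_dual p (H v) *
     (sieve_form L (D1 - dg p)%N (H v) * sieve_form L D2 (H v))); first by apply: eq_bigr => v _; ring.
  rewrite (ind (sieve_dual p)); [|exact: periodic_sieve_dual|by move: le le1; clear; lia].
  by rewrite sum_sieve_dual // mul0r mulr0 mul0r.
rewrite !addr0 mulrDr; congr (_ + _).
rewrite leq_min /B; case: (leqP (dg p) D1) => le1 /=; last first.
  by rewrite mulr0 big1 // => v _; rewrite mul0r mulr0.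
case: (leqP (dg p) D2) => le2; last by rewrite mulr0 big1 // => v _; rewrite !mulr0.
transitivity (\sum_(v : 'rV[F]_n) psi (H v) * sieve_dual p (H v) ^+ 2 *
     (sieve_form L (D1 - dg p)%N (H v) * sieve_form L (D2 - dg p)%N (H v))); first by apply: eq_bigr => v _; ring.
rewrite (ind (fun h => sieve_dual p h ^+ 2)); [|exact: periodic_sieve_dual2|by move: le le1 le2; clear; lia].
rewrite sum_sieve_dual2 // mulrA; congr (_ * sieve_mass L _).
by move: le1 le2; clear; lia.
Qed.

Lemma sieve_wt_ge0 p : omega p < pnorm p -> 0 <= sieve_wt p.
Proof. by move=> lt; rewrite divr_ge0 ?(ltW (omega_gt0 _)) // subr_ge0 ltW. Qed.

Lemma sieve_mass_ge1 L D : {in L, forall p, omega p < pnorm p} -> 1 <= sieve_mass L D.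
Proof.
elim: L D => //= p L IH D hL; have hL' : {in L, forall r, omega r < pnorm r}.
  by move=> r rL; apply: hL; rewrite inE rL orbT.
rewrite (le_trans (IH D hL')) // lerDl; case: ifP => // _.
by rewrite mulr_ge0 ?sieve_wt_ge0 ?hL ?mem_head // (le_trans ler01) // IH.
Qed.

(* sieve_form has second moment sieve_mass and equals sieve_mass on every unsieved h. *)
Lemma sieve_bound L h0 n D : uniq L -> {in L, forall p, mirr p /\ omega p < pnorm p} ->
  (D + D <= n)%N ->
  #|[set v : 'rV[F]_n | all (fun p => ~~ sieved p (h0 + rVpoly v)) L]|%:R * sieve_mass L D
    <= q ^+ n.
Proof.
move=> uL hL le; set G := [set v | _].
have W1 : 1 <= sieve_mass L D by apply: sieve_mass_ge1 => p /hL [].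
have W0 : 0 < sieve_mass L D by apply: lt_le_trans W1.
rewrite -(ler_pM2r W0) -mulrA -expr2.
have := @orthogonality L 1 (fun=> 1) h0 n D D uL.
rewrite minnn sumr_const card_rV natrX => <-; first last.
- by rewrite /dg size_poly1.
- exact: periodic1.
- exact: oner_neq0.
- by move=> p /hL [hp wp]; rewrite coprimep1.
rewrite mulr_natl -sumr_const.
rewrite [leRHS](bigID (mem G)) /= -[leLHS]addr0 lerD //; last first.
  by apply: sumr_ge0 => v _; rewrite mul1r -expr2 sqr_ge0.
apply: ler_sum => v; rewrite inE => gv.
by rewrite mul1r sieve_form_good.
Qed.

End Sieve.

(** * Truncated convolutions of nonnegative sequences *)

Section Convolution.
Variable R : realFieldType.
Implicit Types f g : nat -> R.

(** The sum of f i g j over i + j <= D, that is, the partial sum up to D of the coefficients of a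
    product of two power series. *)
Definition conv f g D : R :=
  \sum_(0 <= i < D.+1) f i * \sum_(0 <= j < (D - i).+1) g j.

Lemma convC f g D : conv f g D = conv g f D.
Proof.
have H f1 g1 : conv f1 g1 D = \sum_(0 <= i < D.+1) \sum_(0 <= j < D.+1)
    (if (i + j <= D)%N then f1 i * g1 j else 0).
  apply: eq_big_nat => i /andP[_ iD]; rewrite mulr_sumr.
  rewrite (big_nat_widen _ _ D.+1) ?ltnS ?leq_subr // big_mkcond /=.
  apply: eq_bigr => j _; congr (if _ then _ else _).
  by move: iD; clear; lia.
rewrite !H exchange_big /=; apply: eq_bigr => i _; apply: eq_bigr => j _.
by rewrite addnC mulrC.
Qed.

Section Step.
Variables (f f' g : nat -> R) (d : nat) (x : R).
Hypotheses (f0 : forall i, 0 <= f i) (f'0 : forall i, 0 <= f' i)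
  (g0 : forall i, 0 <= g i) (x0 : 0 <= x) (x1 : x < 1).
Hypothesis ff' : forall i, f' i <= f i + (if (d <= i)%N then x * f' (i - d)%N else 0).

Let G k : R := \sum_(0 <= j < k.+1) g j.

Let G_ge0 k : 0 <= G k.
Proof. by apply: sumr_ge0 => j _. Qed.

Lemma conv_ge0 D : 0 <= conv f g D.
Proof. by apply: sumr_ge0 => i _; rewrite mulr_ge0 ?G_ge0. Qed.

Lemma conv_le D E : (D <= E)%N -> conv f' g D <= conv f' g E.
Proof.
move=> DE; rewrite /conv [leRHS](big_cat_nat (n := D.+1)) //= -[leLHS]addr0.
apply: lerD; last by apply: sumr_ge0 => i _; rewrite mulr_ge0 ?G_ge0.
apply: ler_sum_nat => i /andP[_ iD]; rewrite ler_wpM2l //.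
rewrite [leRHS](big_cat_nat (n := (D - i).+1)) //= ?ltnS ?leq_sub2r //.
by rewrite lerDl sumr_ge0.
Qed.

(** One substitution of [ff'] inside the convolution. [conv_step2] then bounds the shifted
    convolution by the unshifted one and solves, which gives 1/(1 - x). [conv_step] does this only
    after one exact substitution, and so keeps a shift by d on everything beyond the first term. *)
Lemma conv_step1 D :
  conv f' g D <= conv f g D + (if (d <= D)%N then x * conv f' g (D - d)%N else 0).
Proof.
apply: (@le_trans _ _ (\sum_(0 <= i < D.+1)
   (f i * G (D - i) + (if (d <= i)%N then x * f' (i - d)%N else 0) * G (D - i)))).
  by apply: ler_sum => i _; rewrite -mulrDl ler_wpM2r ?G_ge0.
rewrite big_split /= lerD2l; case: leqP => dD; last first.
  rewrite big1_seq // => i /=; rewrite mem_index_iota /= => iD.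
  by rewrite leqNgt (leq_trans iD dD) mul0r.
rewrite (big_cat_nat (n := d)) //=; last by apply: leqW.
rewrite [X in X + _]big1_seq ?add0r; last first.
  by move=> i /=; rewrite mem_index_iota /= => id; rewrite leqNgt id mul0r.
rewrite -{1}[d]add0n big_addn /conv subSn // mulr_sumr.
apply: ler_sum => i _; rewrite leq_addl addnK -mulrA.
by rewrite addnC subnDA.
Qed.

Lemma conv_step2 D : conv f' g D <= conv f g D / (1 - x).
Proof.
have x1' : 0 < 1 - x by rewrite subr_gt0.
rewrite ler_pdivlMr // mulrBr mulr1 lerBlDr.
apply: le_trans (conv_step1 D) _; rewrite lerD2l; case: ifP => _.
  by rewrite mulrC ler_wpM2r // conv_le // leq_subr.
by rewrite mulr_ge0 // (le_trans _ (conv_le (leq0n D))) // sumr_ge0 // => i _; rewrite mulr_ge0 ?G_ge0.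
Qed.

Lemma conv_step D : conv f' g D <=
  conv f g D + (if (d <= D)%N then x / (1 - x) * conv f g (D - d)%N else 0).
Proof.
apply: le_trans (conv_step1 D) _; rewrite lerD2l; case: ifP => // _.
by rewrite -mulrA ler_wpM2l // mulrC conv_step2.
Qed.

End Step.
End Convolution.

(** * Smooth polynomials and a lower bound for Selberg's sum *)

Section Smooth.
Variables (F : finFieldType) (R : realFieldType) (b : {poly F}).
Implicit Types (p m : {poly F}) (L : seq {poly F}).
Local Notation q := (#|F|%:R : R).
Local Notation pnorm := (pnorm R).

Definition smooth L m := all (fun p => (p %| m) ==> (p \in L)) (irrs F (dg m)).

Lemma smoothP L m : m != 0 ->
  reflect (forall p, mirr p -> p %| m -> p \in L) (smooth L m).
Proof.
move=> m0; apply: (iffP allP) => [h p hp pm|h p].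
  by apply: (implyP (h p _)) => //; rewrite mem_irrs hp -size_dg // dvdp_leq.
by rewrite mem_irrs => /andP[hp _]; apply/implyP/h.
Qed.

Definition smooth_set L i := [set v : 'rV[F]_i | smooth L ('X^i + rVpoly v)].

Definition smooth_density L i : R := #|smooth_set L i|%:R / q ^+ i.

Lemma smooth_density_ge0 L i : 0 <= smooth_density L i.
Proof. by rewrite divr_ge0 // exprn_ge0 // ltW ?qR_gt0. Qed.

Lemma XnD_neq0 i (v : 'rV[F]_i) : 'X^i + rVpoly v != 0.
Proof. by rewrite monic_neq0 ?monic_XnDr. Qed.

Lemma dg_XnD i (v : 'rV[F]_i) : dg ('X^i + rVpoly v) = i.
Proof. by rewrite /dg size_XnDr. Qed.

(** A smooth polynomial for p :: L is either prime to p, hence smooth for L, or p times a smooth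
    polynomial of degree i - dg p. *)
Lemma smooth_density_rec p L i : mirr p -> smooth_density (p :: L) i <=
  smooth_density L i + (if (dg p <= i)%N then (pnorm p)^-1 * smooth_density (p :: L) (i - dg p)%N else 0).
Proof.
move=> hp; have p0 := mirr_neq0 hp.
have key : (#|smooth_set (p :: L) i| <=
    #|smooth_set L i| + if (dg p <= i)%N then #|smooth_set (p :: L) (i - dg p)| else 0)%N.
  rewrite -(cardsID [set v : 'rV[F]_i | ~~ (p %| 'X^i + rVpoly v)]).
  apply: leq_add.
    apply/subset_leq_card/fintype.subsetP => v; rewrite !inE => /andP[/smoothP-/(_ (XnD_neq0 _)) h npv].
    apply/smoothP; rewrite ?XnD_neq0 // => r hr rv.
    have := h r hr rv; rewrite inE => /orP[/eqP e|//].
    by move: npv; rewrite -e rv.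
  case: (leqP (dg p) i) => le; last first.
    rewrite leqn0 cards_eq0; apply/eqP/setP => v; rewrite !inE negbK.
    apply/negP => /andP[/(dvdp_dg (XnD_neq0 _))]; rewrite dg_XnD.
    by rewrite leqNgt le.
  pose f (w : 'rV[F]_(i - dg p)) : 'rV[F]_i := poly_rV (p * ('X^(i - dg p) + rVpoly w) - 'X^i).
  apply: leq_trans (leq_imset_card f _).
  apply/subset_leq_card/fintype.subsetP => v; rewrite !inE negbK.
  case/andP => /dvdpP[m em] /smoothP-/(_ (XnD_neq0 _)) h.
  have m0 : m != 0 by apply: contraNneq (XnD_neq0 v) => m0; rewrite em m0 mul0r.
  have mm : m \is monic by rewrite -(monicMr _ (mirr_monic hp)) -em monic_XnDr.
  have dm : dg m = (i - dg p)%N.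
    by have := dg_XnD v; rewrite em dgM // => <-; rewrite addnK.
  have sm : size m = (i - dg p).+1 by rewrite size_dg // dm.
  have [w ew] := monic_XnDrP mm sm.
  apply/imsetP; exists w; last by rewrite /f -ew (mulrC p) -em addrC addKr rVpolyK.
  rewrite inE -ew; apply/smoothP => // r hr rm; apply: h => //.
  by rewrite em dvdp_mulr.
have qi n : 0 < q ^+ n by rewrite exprn_gt0 ?qR_gt0.
rewrite /smooth_density ler_pdivrMr ?qi // mulrDl divfK ?gt_eqF ?qi //.
move: key; rewrite -(ler_nat R) natrD => /le_trans; apply; rewrite lerD2l.
case: (leqP (dg p) i) => le; last by rewrite mul0r.
have -> : q ^+ i = q ^+ (i - dg p) * q ^+ dg p by rewrite -exprD subnK.
rewrite -[pnorm p]/(q ^+ dg p).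
have h1 := lt0r_neq0 (qi (i - dg p)%N); have h2 := lt0r_neq0 (qi (dg p)).
by rewrite le_eqVlt; apply/orP; left; apply/eqP; field; rewrite h1 h2.
Qed.

Lemma smooth_density_nil i : smooth_density [::] i = (i == 0%N)%:R.
Proof.
rewrite /smooth_density; case: i => [|i] /=.
  rewrite expr0 divr1; congr (_%:R); apply/eqP; rewrite eqn_leq; apply/andP; split.
    by rewrite (leq_trans (max_card _)) // card_rV.
  rewrite card_gt0; apply/set0Pn; exists 0; rewrite inE; apply/smoothP.
    by rewrite XnD_neq0.
  move=> p hp; rewrite linear0 addr0 expr0 => /dvdp_leq.
  by rewrite oner_neq0 size_poly1 leqNgt mirr_size // => /(_ isT).
suff -> : smooth_set [::] i.+1 = set0 by rewrite cards0 mul0r.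
apply/setP => v; rewrite !inE; apply/negP => /smoothP-/(_ (XnD_neq0 _)) h.
have [|p hp pv] := @exists_mirr_factor _ ('X^(i.+1) + rVpoly v).
  by rewrite size_XnDr.
by have := h p hp pv; rewrite in_nil.
Qed.

Lemma smooth_density_irrs M i : (i <= M)%N -> smooth_density (irrs F M) i = 1.
Proof.
move=> iM; rewrite /smooth_density.
suff -> : smooth_set (irrs F M) i = setT.
  by rewrite cardsT card_rV natrX divff // gt_eqF // exprn_gt0 // qR_gt0.
apply/setP => v; rewrite !inE; apply/smoothP; first exact: XnD_neq0.
move=> p hp pv; rewrite mem_irrs hp (leq_trans (dvdp_leq (XnD_neq0 _) pv)) //.
by rewrite size_XnDr.
Qed.

(** The factors are (1 - 1/|p|)^-1, written as 1 plus a nonnegative term so that expanding over sets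
    of primes preserves inequalities. *)
Definition euler_factor L m : R := \prod_(p <- L | p %| m) (1 + (pnorm p - 1)^-1).

Lemma euler_factor_ge1 L m : {in L, forall p, mirr p} -> 1 <= euler_factor L m.
Proof.
move=> hL; rewrite /euler_factor big_seq_cond; elim/big_ind: _ => // [x y|p /andP[/hL hp _]]; first exact: mulr_ege1.
by rewrite lerDl invr_ge0 subr_ge0 ltW // pnorm_gt1.
Qed.

(** Both sides grow prime by prime. Let y = 1/(|p| - 1), d = dg p, and let T^d stand for lowering D
    by d. Adding p multiplies the left side by at most 1 + (2y + y^2) T^d, since (1 - 1/|p|)^-2 = 1
    + 2y + y^2 and higher powers of T^d are replaced by the first. The right side gains the factor 1
    + [sieve_wt p] T^d, and also 1 + y when p divides b. *)
Lemma conv_sieve_mass L D : {in L, forall p, mirr p /\ omega R b p < pnorm p} ->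
  conv (smooth_density L) (smooth_density L) D <= euler_factor L b * sieve_mass R b L D.
Proof.
elim: L D => [|p L IH] D hL.
  rewrite /euler_factor big_nil /= mulr1 /conv.
  have S (h : nat -> R) n : \sum_(0 <= i < n.+1) smooth_density [::] i * h i = h 0%N.
    rewrite big_ltn // smooth_density_nil mul1r big1_seq ?addr0 // => i /=.
    by rewrite mem_index_iota => /andP[i0 _]; rewrite smooth_density_nil gtn_eqF ?mul0r.
  by rewrite S -[leLHS](eq_bigr _ (fun i _ => mulr1 _)) S.
have [hp wp] := hL p (mem_head _ _).
have hL' : {in L, forall r, mirr r /\ omega R b r < pnorm r}.
  by move=> r rL; apply: hL; rewrite inE rL orbT.
have hL'' : {in L, forall r, mirr r} by move=> r /hL' [].
have N1 := pnorm_gt1 R hp; have N0 := pnorm_gt0 R p.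
set N := pnorm p in N1 N0 wp *.
pose x := N^-1; have x0 : 0 <= x by rewrite invr_ge0 ltW.
have x1 : x < 1 by rewrite invf_lt1.
pose y := (N - 1)^-1; have y0 : 0 < y by rewrite invr_gt0 subr_gt0.
have xy : x / (1 - x) = y.
  by rewrite /x /y; field; rewrite subr_eq0 !gt_eqF.
have xy' : (1 - x)^-1 = 1 + y.
  by rewrite /x /y; field; rewrite subr_eq0 !gt_eqF.
have z0 := smooth_density_ge0; set z := smooth_density L; set z' := smooth_density (p :: L).
have zz' i : z' i <= z i + (if (dg p <= i)%N then x * z' (i - dg p)%N else 0).
  exact: smooth_density_rec.
set C := conv z z; have C0 E : 0 <= C E by apply: conv_ge0; apply: z0.
pose C1 := if (dg p <= D)%N then C (D - dg p)%N else 0.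
have s1 : conv z' z' D <= C D + (2 * y + y ^+ 2) * C1.
  have a1 := conv_step (z0 (p :: L)) (z0 (p :: L)) x0 x1 zz' D.
  have a2 := conv_step (z0 (p :: L)) (z0 L) x0 x1 zz' D.
  have a3 E := conv_step2 (z0 (p :: L)) (z0 L) x0 x1 zz' E.
  apply: le_trans a1 _; rewrite -/z -/z' convC.
  apply: le_trans (lerD a2 (lexx _)) _; rewrite -/C xy /C1.
  case: leqP => le; last by rewrite !(mulr0, addr0).
  rewrite -addrA lerD2l; have := a3 (D - dg p)%N; rewrite xy' -/z -/z' convC -/C.
  rewrite -(ler_pM2l y0) => h; apply: le_trans (lerD (lexx _) h) _.
  by rewrite le_eqVlt; apply/orP; left; apply/eqP; ring.
apply: le_trans s1 _.
pose W1 := if (dg p <= D)%N then sieve_mass R b L (D - dg p) else 0.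
have -> : sieve_mass R b (p :: L) D = sieve_mass R b L D + sieve_wt R b p * W1.
  by rewrite /W1 /=; case: ifP => _; rewrite ?mulr0.
set Fc := euler_factor L b; have Fc1 : 1 <= Fc by apply: euler_factor_ge1.
have h0 : C D <= Fc * sieve_mass R b L D by apply: IH.
have h1 : C1 <= Fc * W1.
  by rewrite /C1 /W1; case: ifP => _; [apply: IH|rewrite mulr0].
have C10 : 0 <= C1 by rewrite /C1; case: ifP.
have C1C : C1 <= C D.
  rewrite /C1; case: ifP => // _.
  exact: (conv_le (z0 L) (z0 L) (leq_subr _ _)).
have FcE : euler_factor (p :: L) b = (if p %| b then 1 + y else 1) * Fc.
  by rewrite /euler_factor big_cons; case: ifP; rewrite ?mul1r.
rewrite FcE /sieve_wt -/N; move: wp; rewrite /omega; case: ifP => pb wp.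
  (* Here (1 + y)(1 + y T^d) exceeds 1 + (2y + y^2) T^d by y (1 - T^d), which [C1C] makes
     nonnegative. *)
  rewrite -/y mul1r.
  have : (1 + y) * C D + (1 + y) * y * C1 <= (1 + y) * (Fc * sieve_mass R b L D) + (1 + y) * y * (Fc * W1).
    by apply: lerD; rewrite ler_wpM2l //; nra.
  by nra.
have N2 : 0 < N - 2 by rewrite subr_gt0.
have ww : 2 * y + y ^+ 2 <= 2 / (N - 2).
  rewrite ler_pdivlMr // /y -subr_ge0.
  have -> : 2 - (2 * (N - 1)^-1 + (N - 1)^-1 ^+ 2) * (N - 2) = (N - 1)^-1 + (N - 1)^-1 ^+ 2.
    by field; rewrite subr_eq0 gt_eqF.
  by rewrite addr_ge0 ?sqr_ge0 // invr_ge0 subr_ge0 ltW.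
rewrite mul1r mulrDr; apply: lerD => //.
apply: le_trans (ler_wpM2r C10 ww) _; rewrite mulrCA.
by rewrite ler_wpM2l // divr_ge0 // ltW.
Qed.

(** When L contains all primes of degree at most M, every polynomial of degree at most M is smooth,
    so all densities are 1 and the convolution counts the pairs (i, j) with i + j <= M. *)
Lemma sieve_mass_lower M : {in irrs F M, forall p, omega R b p < pnorm p} ->
  ((M.+1 * M.+2)%:R / 2 : R) <= euler_factor (irrs F M) b * sieve_mass R b (irrs F M) M.
Proof.
move=> hL; apply: le_trans (conv_sieve_mass _ _); last first.
  by move=> p pL; rewrite (mirr_irrs pL) hL.
rewrite /conv (eq_big_nat _ _ (F2 := fun i => ((M - i).+1)%:R)); last first.
  move=> i /andP[_ iM]; rewrite smooth_density_irrs // mul1r (eq_big_nat _ _ (F2 := fun=> 1)).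
    by rewrite sumr_const_nat subn0.
  move=> j /andP[_ jM]; rewrite smooth_density_irrs //.
  by move: iM jM; clear; lia.
rewrite big_nat_rev /= add0n ler_pdivrMr //.
have -> : \sum_(0 <= i < M.+1) ((M - (M.+1 - i.+1)).+1)%:R = \sum_(0 <= i < M.+1) i.+1%:R :> R.
  by apply: eq_big_nat => i /andP[_ iM]; congr (_%:R); move: iM; clear; lia.
elim: M {hL} => [|M IH]; first by rewrite big_nat1 mul1r ler_nat.
rewrite big_nat_recr //= mulrDl; apply: le_trans (lerD IH (lexx _)).
rewrite !natrM -!natr1 le_eqVlt; apply/orP; left; apply/eqP; ring.
Qed.

End Smooth.

(** * Pairs of irreducible polynomials with a given difference *)

Section Twins.
Variables (F : finFieldType) (R : realFieldType).
Implicit Types (p h b : {poly F}).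
Local Notation q := (#|F|%:R : R).

Lemma irr_ndvd p h : irreducible_poly h -> (1 < size p < size h)%N -> p %| h = false.
Proof.
move=> ih /andP[p1 lt]; apply/negP => ph.
have := ih.2 p _ ph; rewrite neq_ltn p1 orbT => /(_ isT) /eqp_size e.
by move: lt; rewrite e ltnn.
Qed.

(** Sieve by all primes of degree at most M = n/2. They have degree below n, so irreducible
    polynomials of degree n survive, and 2M <= n is the level that [sieve_bound] allows. *)
Lemma twin_sieve h0 b n : size h0 = n.+1 -> (size b <= n)%N -> (0 < n)%N ->
  #|[set v : 'rV[F]_n | irreducibleb (h0 + rVpoly v) &&
                        irreducibleb (h0 + rVpoly v + b)]|%:R
     * (n.+1 * n.+3)%:R <= 8 * q ^+ n * euler_factor R (irrs F n./2) b.
Proof.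
move=> sh sb n0; set T := [set v | _]; set L := irrs F _.
have hL p : p \in L -> mirr p by move=> /mirr_irrs.
have Tgood v : v \in T -> all (fun p => ~~ sieved b p (h0 + rVpoly v)) L.
  rewrite inE => /andP[/irreducibleP i1 /irreducibleP i2]; apply/allP => p pL.
  have s1 : size (h0 + rVpoly v) = n.+1.
    by rewrite size_polyDl // sh ltnS size_rVpoly.
  have s2 : size (h0 + rVpoly v + b) = n.+1 by rewrite size_polyDl // s1 ltnS.
  move: pL; rewrite mem_irrs => /andP[hp sp].
  have sp' : (1 < size p < n.+1)%N.
    by rewrite mirr_size //= (leq_ltn_trans sp) // ltnS; move: n0; clear; lia.
  by rewrite /sieved !irr_ndvd ?s1 ?s2.
have F1 : 1 <= euler_factor R L b by apply: euler_factor_ge1 => p /hL.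
have qn0 : 0 <= q ^+ n by rewrite exprn_ge0 ?ltW ?qR_gt0.
have [/allP|/allPn [p pL]] := boolP (all (fun p => omega R b p < pnorm R p) L); last first.
  (* Only possible if |p| = 2 and p does not divide b: then every h is sieved by p. *)
  rewrite -leNgt => wp.
  have hp := hL p pL; have sp := size_dg (mirr_neq0 hp).
  have dn : (dg p <= n)%N.
    by move: pL; rewrite mem_irrs sp ltnS => /andP[_]; move: n0; clear; lia.
  have N2 : 2 <= pnorm R p.
    by rewrite -[pnorm _ _]natrX ler_nat -[X in (X <= _)%N]expn1 (leq_trans _ (leq_pexp2l _ (dg_gt0 hp))) ?(ltnW (qgt1 F)) // expn1 qgt1.
  have [npb eN] : (p %| b) = false /\ pnorm R p = 2.
    move: wp; rewrite /omega; case: ifP => _ wp.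
      by have := le_trans N2 wp; rewrite (ler_nat R 2 1).
    by split=> //; apply/le_anti; rewrite wp N2.
  have all_sieved (v : 'rV[F]_n) : sieved b p (h0 + rVpoly v).
    have z : \sum_(v : 'rV[F]_n) (1 - (sieved b p (h0 + rVpoly v))%:R) = 0 :> R.
      rewrite sumrB sumr_const card_rV natrX (eq_bigr _ (fun v _ => sievedE R b p _)).
      rewrite big_split /= npb !(count_residue R _ _ sp dn) -/(pnorm R p) eN; by field.
    have nn (u : 'rV[F]_n) : true -> 0 <= 1 - (sieved b p (h0 + rVpoly u))%:R :> R.
      by move=> _; rewrite subr_ge0; case: sieved.
    have := psumr_eq0P nn z (i := v) isT.
    by case: sieved => // /eqP; rewrite subr0 oner_eq0.
  suff -> : T = set0 by rewrite cards0 mul0r !mulr_ge0 // (le_trans ler01).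
  apply/setP => v; rewrite [RHS]inE; apply/negP => /Tgood /allP /(_ p pL).
  by rewrite all_sieved.
move=> wL; set M := n./2 in L hL Tgood F1 wL *.
have W1 : 1 <= sieve_mass R b L M by apply: sieve_mass_ge1 => p /wL.
have sv : #|T|%:R * sieve_mass R b L M <= q ^+ n.
  have MM : (M + M <= n)%N by rewrite /M; lia.
  have := @sieve_bound F R b L h0 n M (uniq_irrs _ _) _ MM.
  move=> /(_ (fun p pL => conj (hL p pL) (wL p pL))); apply: le_trans.
  rewrite ler_wpM2r ?(le_trans ler01) // ler_nat subset_leq_card //.
  by apply/fintype.subsetP => v /Tgood; rewrite inE.
have lo := sieve_mass_lower wL; rewrite -/L in lo.
(* Equality for odd n, where n + 1 = 2 (M + 1) and n + 3 = 2 (M + 2). *)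
have nM : (n.+1 * n.+3)%:R <= 8 * ((M.+1 * M.+2)%:R / 2) :> R.
  have -> : 8 * ((M.+1 * M.+2)%:R / 2) = (4 * (M.+1 * M.+2))%:R :> R.
    by rewrite [in RHS]natrM; field.
  rewrite ler_nat /M.
  by have : (n <= n./2.*2.+1)%N; [lia|move: (n./2) => m; clear; nia].
have T0 : 0 <= #|T|%:R :> R by [].
apply: le_trans (ler_wpM2l T0 nM) _; rewrite mulrCA -mulrA ler_pM2l ?ltr0n //.
apply: le_trans (ler_wpM2l T0 lo) _; rewrite mulrCA mulrC ler_wpM2r //.
by rewrite (le_trans ler01).
Qed.

(** The coefficient of X^n is kept apart: once it is fixed, the rest runs through a full vector
    space, which is the setting of the sieve. *)
Definition hpoly n (x : F * 'rV[F]_n) : {poly F} := x.1 *: 'X^n + rVpoly x.2.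

Lemma size_hpoly n (x : F * 'rV[F]_n) : size (hpoly x) = n.+1 <-> x.1 != 0.
Proof.
split=> [s|x1].
  apply/eqP => x1; move: s; rewrite /hpoly x1 scale0r add0r => s.
  by have := size_rVpoly x.2; rewrite s ltnn.
by rewrite /hpoly size_polyDl ?size_scale ?size_polyXn // ltnS size_rVpoly.
Qed.

Lemma irreducibleb_scale c h : c != 0 -> irreducibleb (c *: h) = irreducibleb h.
Proof.
move=> c0.
have H (k : {poly F}) (d : F) : d != 0 -> irreducibleb k -> irreducibleb (d *: k).
  move=> d0 /irreducibleP ik; apply/irreducibleP.
  have e : d *: k %= k by apply: eqp_scale.
  split; first by rewrite (eqp_size e) ik.1.
  move=> r sr; rewrite (eqp_dvdr _ e) => rk.
  by rewrite (eqp_trans (ik.2 r sr rk)) // eqp_sym.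
apply/idP/idP => [|/H]; last exact.
by move/H => /(_ c^-1); rewrite scalerA mulVf // scale1r invr_eq0; apply.
Qed.

Definition irrset n := [set x : F * 'rV[F]_n | (x.1 != 0) && irreducibleb (hpoly x)].

Lemma primepiE n : primepi F n = #|[set v : 'rV[F]_n | irreducibleb ('X^n + rVpoly v)]|.
Proof.
rewrite /primepi /irr filter_map size_map cardsE cardE /enum_mem -filter_predI.
by congr size; apply: eq_filter => v; rewrite /= andbT.
Qed.

Lemma card_pair n (P : F -> pred 'rV[F]_n) :
  #|[set x : F * 'rV[F]_n | (x.1 != 0) && P x.1 x.2]| =
  (\sum_(c : F | c != 0%R) #|[set v : 'rV[F]_n | P c v]|)%N.
Proof.
rewrite -sum1_card; under eq_bigl do rewrite inE.
rewrite -(pair_big_dep (fun c => c != 0) (fun c v => P c v) (fun _ _ => 1%N)) /=.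
by apply: eq_bigr => c _; rewrite -sum1_card; apply: eq_bigl => v; rewrite inE.
Qed.

Lemma card_nz : #|[pred c : F | c != 0]| = #|F|.-1.
Proof. by rewrite cardC1. Qed.

Lemma card_irrset n : #|irrset n| = (#|F|.-1 * primepi F n)%N.
Proof.
rewrite /irrset (card_pair (fun c v => irreducibleb (hpoly (c, v)))).
rewrite (eq_bigr (fun=> primepi F n)) => [|c c0].
  by rewrite sum_nat_const card_nz.
rewrite primepiE -[RHS](card_imset _ (scalerI c0)); apply: eq_card => v.
rewrite inE; apply/idP/imsetP => [iv|[w]].
  exists (c^-1 *: v); last by rewrite scalerA divff // scale1r.
  rewrite inE -(irreducibleb_scale _ c0) scalerDr linearZ /= scalerA divff //.
  by rewrite scale1r.
rewrite inE => iw ->; rewrite /hpoly /= linearZ /= -scalerDr.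
by rewrite irreducibleb_scale.
Qed.

Lemma twin_count b n : (size b <= n)%N -> (0 < n)%N ->
  #|[set x in irrset n | irreducibleb (hpoly x + b)]|%:R * (n.+1 * n.+3)%:R
  <= (q - 1) * (8 * q ^+ n * euler_factor R (irrs F n./2) b).
Proof.
move=> sb n0.
have -> : [set x in irrset n | irreducibleb (hpoly x + b)] =
   [set x : F * 'rV[F]_n | (x.1 != 0) && (irreducibleb (hpoly (x.1, x.2)) && irreducibleb (hpoly (x.1, x.2) + b))].
  by apply/setP => -[c v]; rewrite !inE andbA.
rewrite (card_pair (fun c v => irreducibleb (hpoly (c, v)) && irreducibleb (hpoly (c, v) + b))).
rewrite natr_sum mulr_suml.
have -> : q - 1 = #|[pred c : F | c != 0]|%:R.
  by rewrite card_nz -subn1 natrB // ltnW // qgt1.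
rewrite mulr_natl -sumr_const; apply: ler_sum => c c0.
have := @twin_sieve (c *: 'X^n) b n.
by rewrite size_scale ?size_polyXn //; exact.
Qed.
End Twins.

(** * Romanoff averaging *)

Section Averaging.
Variable R : realFieldType.
Implicit Types f g : nat -> R.

(* The weights 1/(x(x+1)), x < k, and 1/k come from Abel summation; they sum to 1. *)
Definition avg f k : R :=
  \sum_(1 <= x < k) f x / (x%:R * x.+1%:R) + f k / k%:R.

Lemma avg_le f g k : (forall x, (0 < x <= k)%N -> f x <= g x) -> (0 < k)%N ->
  avg f k <= avg g k.
Proof.
move=> fg k0; apply: lerD; last by rewrite ler_wpM2r ?invr_ge0 // fg // k0 leqnn.
apply: ler_sum_nat => x /andP[x0 xk]; rewrite ler_wpM2r ?invr_ge0 ?mulr_ge0 //.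
by rewrite fg // x0 ltnW.
Qed.

Lemma avgD f g k : avg (fun x => f x + g x) k = avg f k + avg g k.
Proof.
rewrite /avg (eq_bigr _ (fun x _ => mulrDl _ _ _)) big_split /= mulrDl.
by rewrite addrACA.
Qed.

Lemma avgZ c f k : avg (fun x => c * f x) k = c * avg f k.
Proof.
by rewrite /avg mulrDr mulr_sumr mulrA; congr (_ + _); apply: eq_bigr => x _; rewrite mulrA.
Qed.

Lemma avgS f k : (0 < k)%N -> avg f k.+1 = avg f k + (f k.+1 - f k) / k.+1%:R.
Proof.
move=> k0; rewrite /avg big_nat_recr //= -addrA -addrA; congr (_ + _).
have k1 : k%:R != 0 :> R by rewrite pnatr_eq0 -lt0n.
by field; rewrite k1 addrC natr1 pnatr_eq0.
Qed.

Lemma avg_mono f k m : (forall x, (0 < x)%N -> f x <= f x.+1) -> (0 < k <= m)%N ->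
  avg f k <= avg f m.
Proof.
move=> fm /andP[k0 km]; elim: m km => [|m IH]; first by rewrite leqn0 => /eqP ->.
rewrite leq_eqVlt => /orP[/eqP -> //|km]; apply: le_trans (IH km) _.
have m0 : (0 < m)%N := leq_trans k0 km.
by rewrite avgS // lerDl divr_ge0 // subr_ge0 fm.
Qed.

Lemma avg_ge f k l : (forall x, 0 <= f x) -> (forall x, (l <= x)%N -> 1 <= f x) ->
  (0 < l <= k)%N -> l%:R^-1 <= avg f k.
Proof.
move=> f0 f1 /andP[l0 lk]; elim: k lk => [|k IH]; first by rewrite leqn0 => /eqP ->; rewrite invr0 /avg big_geq // add0r invr0 mulr0.
rewrite leq_eqVlt => /orP[/eqP <-|lk].
  rewrite /avg -[leLHS]add0r lerD //; first by apply: sumr_ge0 => x _; rewrite divr_ge0 ?mulr_ge0.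
  by rewrite -[leLHS]mul1r ler_wpM2r ?invr_ge0 // f1.
have k0 : (0 < k)%N := leq_trans l0 lk.
pose h x := if (l <= x)%N then 1 else 0 : R.
(* The weights telescope: those of all x >= l add up to exactly 1/l. *)
have hE m : (l <= m)%N -> avg h m = l%:R^-1.
  elim: m => [|m IHm]; first by rewrite leqn0 => /eqP e; move: l0; rewrite e.
  rewrite leq_eqVlt => /orP[/eqP e|lm].
    rewrite /avg -e /h leqnn big1_seq ?add0r ?mul1r // => x /=.
    by rewrite mem_index_iota => /andP[_ xl]; rewrite leqNgt xl mul0r.
  have lm' : (l <= m)%N := lm.
  by rewrite avgS ?(leq_trans l0) // IHm // /h lm' (leqW lm') subrr mul0r addr0.
rewrite -(hE k.+1 (leqW lk)); apply: avg_le => // x _.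
by rewrite /h; case: leqP => // /f1.
Qed.

End Averaging.

Section Romanoff.
Variables (F : finFieldType) (R : realFieldType) (g : {poly F}).
Hypothesis g1 : (0 < dg g)%N.
Implicit Types (p m : {poly F}) (L : seq {poly F}).

(** The extra factor g accounts for the primes of g in g^k - g^l = g^l (g^(k-l) - 1). *)
Definition gpow j : {poly F} := g * (g ^+ j - 1).
(** A polynomial divisible by every prime of [gpow l] for 1 <= l <= x. Taking g (g - 1) once and
    then only the cofactors (g^i - 1)/(g - 1) keeps its degree low. *)
Definition gprod x : {poly F} :=
  g * (g - 1) * \prod_(2 <= i < x.+1) \sum_(j < i) g ^+ j.

(** Euclid's subtraction: g^j - g^i = g^i (g^(j-i) - 1), and any prime dividing g divides every
    [gpow]. *)
Lemma gpow_sub p i j : irreducible_poly p -> (i <= j)%N ->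
  p %| gpow i -> p %| gpow j -> p %| gpow (j - i).
Proof.
move=> ip ij; rewrite /gpow !irr_dvdM // => /orP[->//|hi] /orP[->//|hj].
apply/orP; right.
have : p %| g ^+ i * (g ^+ (j - i) - 1).
  rewrite mulrBr mulr1 -exprD subnKC //.
  have -> : g ^+ j - g ^+ i = (g ^+ j - 1) - (g ^+ i - 1) by rewrite opprB addrA subrK.
  by rewrite dvdp_subl.
rewrite irr_dvdM // => /orP[/irr_dvdX-/(_ ip) pg|//].
case: i {ij} hi => [|i] hi; first by rewrite subn0.
have : p %| 1 by move: hi; rewrite dvdp_subr // exprS dvdp_mulr.
by rewrite dvdp1 => /eqP s1; move: (ip.1); rewrite s1.
Qed.

Lemma gpow_gprod p l x : irreducible_poly p -> (0 < l <= x)%N -> p %| gpow l -> p %| gprod x.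
Proof.
move=> ip /andP[l0 lx]; rewrite /gpow subrX1 /gprod !irr_dvdM //.
case/or3P => [->//|->|h]; first by rewrite orbT.
case: l l0 lx h => [//|[|l]] _ lx h.
  have : p %| 1 by move: h; rewrite big_ord1 expr0.
  by rewrite dvdp1 => /eqP s1; move: (ip.1); rewrite s1.
rewrite (bigD1_seq l.+2) ?iota_uniq ?mem_index_iota //= irr_dvdM // h.
by rewrite orbT.
Qed.

Lemma count_multiples l k : (0 < l)%N ->
  (\sum_(1 <= j < k.+1) (l %| j) = k %/ l)%N.
Proof.
move=> l0; elim: k => [|k IH]; first by rewrite big_geq // div0n.
by rewrite big_nat_recr //= IH divnS // addnC.
Qed.

(** Let l be the least positive index at which all of S divides. By [gpow_sub] every such index is a
    multiple of l, so at most k/l occur up to k. From x = l on, all of S divides [gprod x], so the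
    average on the right is at least 1/l. *)
Lemma romanoff_base (S : seq {poly F}) k : (0 < k)%N ->
  {in S, forall p, irreducible_poly p} ->
  \sum_(1 <= j < k.+1) ((all (fun p => p %| gpow j) S)%:R : R) <=
  k%:R * avg (fun x => (all (fun p => p %| gprod x) S)%:R) k.
Proof.
move=> k0 hS; set P := fun j => all (fun p => p %| gpow j) S.
have [/hasP[j0]|/hasPn nP] := boolP (has P (index_iota 1 k.+1)); last first.
  rewrite big1_seq => [|j /= /nP /negPf]; last by rewrite /P => ->.
  rewrite mulr_ge0 // addr_ge0 ?divr_ge0 // sumr_ge0 // => x _.
  by rewrite divr_ge0 ?mulr_ge0.
rewrite mem_index_iota => /andP[j00 j0k] Pj0.
have ex : exists j, (0 < j)%N && P j by exists j0; rewrite j00.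
case: (ex_minnP ex) => l /andP[l0 Pl] lmin.
have lk : (l <= k)%N by rewrite (leq_trans (lmin j0 _)) ?j00.
have mult j : (0 < j)%N -> P j -> (l %| j)%N.
  elim/ltn_ind: j => j IH jp Pj.
  have lj : (l <= j)%N by apply: lmin; rewrite jp.
  have [->|ne] := eqVneq l j; first exact: dvdnn.
  have ltlj : (l < j)%N by rewrite ltn_neqAle ne.
  rewrite -(subnK lj) dvdn_addl // IH ?subn_gt0 //.
    by rewrite ltn_subrL l0 (leq_trans l0).
  apply/allP => p pS.
  exact: gpow_sub (hS p pS) lj (allP Pl p pS) (allP Pj p pS).
apply: (@le_trans _ _ (\sum_(1 <= j < k.+1) (l %| j)%:R)).
  apply: ler_sum_nat => j /andP[jp _]; rewrite ler_nat.
  by rewrite -/(P j); case: (boolP (P j)) => // Pj; rewrite (mult j jp Pj).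
rewrite -natr_sum count_multiples //.
apply: (@le_trans _ _ (k%:R / l%:R)).
  by rewrite ler_pdivlMr ?ltr0n // -natrM ler_nat leq_trunc_div.
rewrite ler_wpM2l // avg_ge ?l0 // => x lx.
rewrite (_ : all _ _ = true) //; apply/allP => p pS.
by apply: gpow_gprod (hS p pS) _ (allP Pl p pS); rewrite l0.
Qed.

(** The Euler product is expanded one prime of L at a time; S collects the primes already selected,
    which are required to divide. *)
Lemma romanoff_avg L (S : seq {poly F}) k : (0 < k)%N ->
  {in S, forall p, irreducible_poly p} -> {in L, forall p, mirr p} ->
  \sum_(1 <= j < k.+1) (all (fun p => p %| gpow j) S)%:R * euler_factor R L (gpow j) <=
  k%:R * avg (fun x => (all (fun p => p %| gprod x) S)%:R * euler_factor R L (gprod x)) k.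
Proof.
move=> k0; elim: L S => [|p L IH] S hS hL.
  under eq_bigr do rewrite /euler_factor big_nil mulr1.
  apply: le_trans (romanoff_base k0 hS) _; rewrite ler_wpM2l //.
  by apply: avg_le => // x _; rewrite /euler_factor big_nil mulr1.
have hp := hL p (mem_head _ _).
have hL' : {in L, forall r, mirr r} by move=> r rL; rewrite hL // inE rL orbT.
have hpS : {in p :: S, forall r, irreducible_poly r}.
  by move=> r; rewrite inE => /predU1P[->|/hS//]; apply: mirr_irr.
set f := (pnorm R p - 1)^-1.
have f0 : 0 <= f by rewrite invr_ge0 subr_ge0 ltW // pnorm_gt1.
have FE m : (all (fun p => p %| m) S)%:R * euler_factor R (p :: L) m =
   (all (fun p => p %| m) S)%:R * euler_factor R L m + f * ((all (fun p => p %| m) (p :: S))%:R * euler_factor R L m).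
  rewrite /euler_factor big_cons /= -/f; case: (p %| m) => /=; [ring|by rewrite !(mul0r, mulr0, addr0)].
rewrite (eq_bigr _ (fun j _ => FE (gpow j))) big_split /= -mulr_sumr.
apply: le_trans (lerD (IH S hS hL') (ler_wpM2l f0 (IH (p :: S) hpS hL'))) _.
rewrite mulrCA -mulrDr ler_wpM2l // -avgZ -avgD.
by apply: avg_le => // x _; rewrite FE.
Qed.

Lemma euler_factor_le L m m' : {in L, forall p, mirr p} ->
  {in L, forall p, p %| m -> p %| m'} -> euler_factor R L m <= euler_factor R L m'.
Proof.
move=> hL h; rewrite /euler_factor big_mkcond [leRHS]big_mkcond /= big_seq [leRHS]big_seq.
apply: ler_prod => p pL.
have f0 : 0 <= (pnorm R p - 1)^-1 by rewrite invr_ge0 subr_ge0 ltW // pnorm_gt1 // hL.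
case: ifP => pm; last by rewrite ler01 /=; case: ifP => // _; rewrite lerDl.
by rewrite (h p pL pm) addr_ge0 //= .
Qed.

Lemma dg_subr1 m : (0 < dg m)%N -> dg (m - 1) = dg m.
Proof.
move=> m0; rewrite /dg size_polyDl // size_polyN size_poly1.
by move: m0; rewrite /dg; case: (size m) => // -[].
Qed.

Lemma dg_gprod x : (0 < x)%N -> dg (gprod x) = (dg g * (2 + 'C(x, 2)))%N.
Proof.
have gn0 : g != 0 by apply: contraTneq g1 => ->; rewrite /dg size_poly0.
have gm1 : dg (g - 1) = dg g by apply: dg_subr1.
have gm1n : g - 1 != 0 by apply: contraTneq g1 => e; rewrite -gm1 e /dg size_poly0.
have geom i : (0 < i)%N -> \sum_(j < i) g ^+ j != 0 /\ dg (\sum_(j < i) g ^+ j) = (dg g * i.-1)%N.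
  move=> i0; have := subrX1 g i; set S := \sum_(j < i) _ => e.
  have d : dg (g ^+ i - 1) = (dg g * i)%N by rewrite dg_subr1 dgX // muln_gt0 g1.
  have S0 : S != 0.
    apply: contraTneq i0 => S0; move: d; rewrite e S0 mulr0 /dg size_poly0.
    by move/esym/eqP; rewrite muln_eq0 -/(dg g) (gtn_eqF g1) /= => /eqP ->.
  have : (dg g * i.-1.+1 = dg g + dg S)%N by rewrite prednK // -d e dgM // gm1.
  by rewrite mulnS => /addnI <-.
case: x => // x _; elim: x => [|x].
  by rewrite /gprod big_geq // mulr1 dgM // gm1 bin_small // addn0 muln2 addnn.
rewrite /gprod => IH; rewrite [in RHS]binS bin1.
have [S0 dS] := geom x.+2 isT.
rewrite big_nat_recr //= mulrA dgM //; first by rewrite IH dS /= -mulnDr addnA.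
rewrite !mulf_neq0 // prodf_seq_neq0; apply/allP => i; rewrite mem_index_iota => /andP[i0 _].
by have [] := geom i (ltnW i0).
Qed.

Lemma gprod_neq0 x : (0 < x)%N -> gprod x != 0.
Proof.
move=> x0; apply: contraTneq g1 => e; have := dg_gprod x0.
by rewrite e /dg size_poly0 => /esym/eqP; rewrite muln_eq0 => /orP[/eqP ->|].
Qed.

Lemma gprod_dvd x : (0 < x)%N -> gprod x %| gprod x.+1.
Proof.
by move=> x0; rewrite /gprod [X in _ %| _ * X]big_nat_recr //= mulrA dvdp_mulr.
Qed.

(** The product of distinct primes dividing m divides m. *)
Lemma sum_dg_dvd L m : uniq L -> {in L, forall p, mirr p} -> m != 0 ->
  (\sum_(p <- L | (p %| m)%R) dg p <= dg m)%N.
Proof.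
move=> uL hL m0.
have H : (\prod_(p <- L | p %| m) p != 0) && (\prod_(p <- L | p %| m) p %| m) &&
   (dg (\prod_(p <- L | p %| m) p)%R == \sum_(p <- L | (p %| m)%R) dg p)%N.
  elim: L uL hL => [|p L IH] /=; first by rewrite !big_nil oner_neq0 dvd1p /dg size_poly1.
  move=> /andP[pL uL] hL; have hp := hL p (mem_head _ _).
  have hL' : {in L, forall r, mirr r} by move=> r rL; rewrite hL // inE rL orbT.
  have := IH uL hL'; rewrite !big_cons; case: ifP => // pm.
  set P := \prod_(r <- L | _) r => /andP[/andP[P0 Pm] /eqP dP].
  have p0 := mirr_neq0 hp.
  rewrite mulf_neq0 //= dgM // dP eqxx andbT Gauss_dvdp ?pm //.
  rewrite /P big_seq_cond; elim/big_ind: _ => [|a b ca cb|r /andP[rL _]].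
  - exact: coprimep1.
  - by rewrite coprimepMr ca.
  by apply: mirr_coprime hp (hL' r rL) _; apply: contra pL => /eqP ->.
by case/andP: H => /andP[_ dv] /eqP <-; apply: dvdp_dg.
Qed.

End Romanoff.

From mathcomp Require Import all_classical all_reals all_analysis.
Import Order.TTheory GRing.Theory Num.Theory.
Import numFieldNormedType.Exports.
Local Open Scope ring_scope.

(** * Harmonic sums and Euler's constant *)

Section Gamma.
Variable R : realType.

(** The difference of the sides vanishes at 0 and has derivative (1 - (1 - x) e^x)/2, nonnegative
    because 1 - x <= e^(-x). *)
Lemma expR_le_pade (y : R) : 0 <= y -> (1 - y / 2) * expR y <= 1 + y / 2.
Proof.
move=> y0; rewrite -subr_ge0.
pose f (x : R) : R := (1 + x / 2) - (1 - x / 2) * expR x.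
have df (x : R) : is_derive x 1 f (2^-1 - (- 2^-1 * expR x + (1 - x / 2) * expR x)).
  rewrite /f.
  apply: is_derive_eq.
  rewrite /GRing.scale /=; ring.
have f'ge0 (x : R) : 0 <= derive1 f x.
  have dfx := df x; rewrite derive1E derive_val.
  have := expR_ge1Dx (- x); rewrite expRN -(ler_pM2r (expR_gt0 x)) mulVf ?gt_eqF ?expR_gt0 //.
  lra.
have -> : 0 = f 0 by rewrite /f mul0r addr0 subr0 mul1r expR0 subrr.
apply: (@ger0_derive1_ndecr R f 0 y) => // x.
by apply/continuous_subspaceT => z; apply/differentiable_continuous/derivable1_diffP.
Qed.

Lemma expR_ge_cubic (y : R) : 0 <= y -> 1 + y + y ^+ 2 / 2 + y ^+ 3 / 6 <= expR y.
Proof.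
move=> y0.
have nd : nondecreasing_seq (series (exp_coeff y)).
  apply/nondecreasing_seqP => n; rewrite -subr_ge0 seriesSB.
  by rewrite /exp_coeff /= divr_ge0 // exprn_ge0.
have := nondecreasing_cvgn_le nd (is_cvg_series_exp_coeff y) 4.
apply: le_trans; rewrite /series /= !big_nat_recr //= big_geq // /exp_coeff /=.
rewrite add0r !factS fact0 expr0 expr1 /=; lra.
Qed.

Definition harm m : R := \sum_(1 <= k < m.+1) k%:R^-1.

Lemma harmS m : harm m.+1 = harm m + m.+1%:R^-1.
Proof. by rewrite /harm big_nat_recr. Qed.

Lemma harm0 : harm 0 = 0. Proof. by rewrite /harm big_geq. Qed.

Lemma harm1 : harm 1 = 1. Proof. by rewrite harmS harm0 add0r invr1. Qed.

(** The sixth power of the Padé bound at 1/6. The value 30/11 = (20/11)(3/2) is the case m = 1 of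
    [expR_harm_hi]. *)
Lemma expR1_le : expR 1 <= 30 / 11 :> R.
Proof.
have h := @expR_le_pade 6^-1.
have h1 : expR (6^-1) <= 13 / 11 :> R by have := h _; lra.
have e : 1 = 6%:R * 6^-1 :> R by rewrite divff // pnatr_eq0.
rewrite [X in expR X]e expRM_natl; apply: (@le_trans _ _ ((13 / 11) ^+ 6)).
  by rewrite lerXn2r // nnegrE ?expR_ge0 //; lra.
by lra.
Qed.

(** With y = 1/(m + 1), the quotient (m + 3/2)/(m + 1/2) is exactly (1 + y/2)/(1 - y/2), so exp(harm
    m)/(m + 1/2) does not increase. *)
Lemma expR_harm_hi m : (0 < m)%N -> expR (harm m) <= 20 / 11 * (m%:R + 1 / 2).
Proof.
case: m => // m _; elim: m => [|m IH].
  by rewrite harm1; have := expR1_le; lra.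
rewrite harmS expRD; set y : R := _^-1.
have M0 : 0 < m.+1%:R :> R by rewrite ltr0n.
have y0 : 0 <= y by rewrite invr_ge0.
have hy := expR_le_pade y0.
rewrite -[m.+2%:R]natr1; set M : R := m.+1%:R in M0 IH *.
have ey : y * (M + 1) = 1 by rewrite /y /M natr1 mulVf // pnatr_eq0.
have hy' : (M + 1 / 2) * expR y <= M + 3 / 2.
  have -> : M + 1 / 2 = (1 - y / 2) * (M + 1) by lra.
  have -> : M + 3 / 2 = (1 + y / 2) * (M + 1) by lra.
  by rewrite mulrAC ler_wpM2r //; lra.
apply: le_trans (ler_wpM2r (expR_ge0 _) IH) _.
by lra.
Qed.

(* The shift 11/20 makes expR (harm m) / (m + 11/20) nondecreasing, while 20/11 is
   still large enough for expR_harm_hi. *)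
Lemma expR_harm_ratio m n : (0 < m <= n)%N ->
  expR (harm m) / (m%:R + 11 / 20) <= expR (harm n) / (n%:R + 11 / 20).
Proof.
move=> /andP[m0]; elim: n => [|n IH]; first by rewrite leqn0 => /eqP ->.
rewrite leq_eqVlt => /orP[/eqP -> //|mn]; apply: le_trans (IH mn) _.
have n0 : (0 < n)%N := leq_trans m0 mn.
rewrite harmS expRD; set y : R := n.+1%:R^-1.
have M0 : 1 <= n%:R :> R by rewrite ler1n.
rewrite -[n.+1%:R]natr1; set M : R := n%:R in M0 *.
have ey : y * (M + 1) = 1 by rewrite /y /M natr1 mulVf // pnatr_eq0.
have y0 : 0 < y by rewrite invr_gt0 ltr0n.
have y1 : y <= 1 / 2 by nra.
have hy := expR_ge_cubic (ltW y0).
rewrite -mulrA ler_pM2l ?expR_gt0 // ler_pdivlMr; last by lra.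
rewrite mulrC ler_pdivrMr; last by lra.
apply: le_trans (ler_wpM2r _ hy); last by lra.
have yV : y^-1 = M + 1.
  by apply: (mulfI (lt0r_neq0 y0)); rewrite ey mulfV // lt0r_neq0.
have -> : M = y^-1 - 1 by rewrite yV; lra.
rewrite -(ler_pM2l y0) [leRHS]mulrC -mulrA.
have e1 : y * (y^-1 - 1 + 1 + 11 / 20) = 1 + 11 / 20 * y by field; exact: lt0r_neq0.
have e2 : (y^-1 - 1 + 11 / 20) * y = 1 - 9 / 20 * y by field; exact: lt0r_neq0.
rewrite e1 e2; nra.
Qed.

Lemma ln_natS_le n : (0 < n)%N -> n.+1%:R^-1 <= ln (n.+1%:R) - ln n%:R :> R.
Proof.
move=> n0; rewrite -ler_expR expRB !lnK ?posrE ?ltr0n //.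
have N0 : 0 < n%:R :> R by rewrite ltr0n.
rewrite ler_pdivlMr // -[n.+1%:R]natr1 mulrC.
set y := (_ + 1)^-1.
have := expR_ge1Dx (- y); rewrite expRN -(ler_pM2r (expR_gt0 y)) mulVf ?gt_eqF ?expR_gt0 //.
have -> : 1 - y = n%:R / (n%:R + 1) by rewrite /y; field; rewrite gt_eqF // ltr_wpDr.
by rewrite mulrAC ler_pdivrMr ?mul1r // ltr_wpDr.
Qed.

(** By [expR_harm_ratio] the left side is at most exp(harm n)/(n + 11/20), hence at most exp(harm n
    - ln n), for all n >= m; let n tend to infinity. *)
Lemma euler_gamma_ge m : (0 < m)%N ->
  expR (harm m) / (m%:R + 11 / 20) <= expR (euler_gamma R).
Proof.
move=> m0; have C0 k : 0 < k%:R + 11 / 20 :> R by rewrite ltr_wpDl // ; lra.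
set b := expR (harm m) / _; have b0 : 0 < b by rewrite divr_gt0 ?expR_gt0.
have bp : b \in Num.pos by rewrite posrE.
suff h : ln b <= euler_gamma R by rewrite -(lnK bp) ler_expR.
pose u (n : nat) : R := harm n - ln n%:R.
have ub k n : (0 < k <= n)%N -> ln (expR (harm k) / (k%:R + 11 / 20)) <= u n.
  move=> /andP[k0 kn]; have n0 : (0 < n)%N := leq_trans k0 kn.
  rewrite -ler_expR lnK ?posrE ?divr_gt0 ?expR_gt0 // /u expRB lnK ?posrE ?ltr0n //.
  apply: le_trans (expR_harm_ratio _) _; first by rewrite k0; exact: kn.
  rewrite ler_pM2l ?expR_gt0 // lef_pV2 ?posrE ?ltr0n //.
  by rewrite lerDl; lra.
have cu : cvgn u.
  (* The shift avoids n = 0, where [ln 0] is 0 by default and u 0 = 0 < u 1 breaks monotonicity. *)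
  have := @nonincreasing_cvgn R (fun n => u n.+1).
  have /[swap]/[apply] : has_lbound (range (fun n => u n.+1)).
    exists (ln (expR (harm 1) / (1%:R + 11 / 20))) => _ [n _ <-].
    exact: ub.
  have /[swap]/[apply] : nonincreasing_seq (fun n => u n.+1).
    apply/nonincreasing_seqP => n /=; rewrite /u (harmS n.+1).
    have := @ln_natS_le n.+1 isT; set a := _^-1; set l1 := ln _; set l2 := ln _; lra.
  by rewrite (@cvg_shiftS R u) => /cvgP.
rewrite /euler_gamma; apply: limr_ge; first exact: cu.
near=> n; apply: ub; rewrite m0 /=; near: n.
exact: nbhs_infty_ge.
Unshelve. all: by end_near. Qed.

Local Notation eg := (expR (euler_gamma R)).

(** With E the left side, [euler_gamma_ge] gives E - e^gamma m <= (11/20) E/(m + 11/20), and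
    [expR_harm_hi] makes this at most 1. *)
Lemma expR_harm_le m : expR (harm m) <= 1 + eg * m%:R.
Proof.
case: (posnP m) => [->|m0]; first by rewrite harm0 expR0 mulr0 addr0.
have M0 : 1 <= m%:R :> R by rewrite ler1n.
have h1 := expR_harm_hi m0; have := euler_gamma_ge m0.
have C0 : 0 < m%:R + 11 / 20 :> R by lra.
rewrite ler_pdivrMr //; set E := expR _ in h1 *; set M := m%:R in M0 h1 C0 *.
move=> h2; rewrite -(ler_pM2r C0).
have : E * M <= eg * (M + 11 / 20) * M by rewrite ler_wpM2r //; lra.
nra.
Qed.

End Gamma.

(** * Convexity, numerical logarithms and tails of averages *)

Section RealLemmas.
Variable R : realType.

Lemma expR_convex (a b t : R) : 0 <= t <= 1 ->
  expR ((1 - t) * a + t * b) <= (1 - t) * expR a + t * expR b.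
Proof.
move=> /andP[t0 t1]; set c := _ + t * b.
have tangent (x z : R) : expR z * (1 + (x - z)) <= expR x.
  rewrite -[X in _ <= expR X](subrK z) expRD [leRHS]mulrC ler_pM2l ?expR_gt0 //.
  exact: expR_ge1Dx.
have t1' : 0 <= 1 - t by lra.
have := lerD (ler_wpM2l t1' (tangent a c)) (ler_wpM2l t0 (tangent b c)).
apply: le_trans.
by rewrite le_eqVlt; apply/orP; left; apply/eqP; rewrite /c; ring.
Qed.

Lemma ln_concave (a b t : R) : 0 <= t <= 1 -> 0 < a -> 0 < b ->
  (1 - t) * ln a + t * ln b <= ln ((1 - t) * a + t * b).
Proof.
move=> t01 a0 b0; have := expR_convex (ln a) (ln b) t01.
rewrite !lnK ?posrE // => h; rewrite -ler_expR lnK // posrE.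
exact: lt_le_trans (expR_gt0 _) h.
Qed.

Lemma ln_le_sub1 (x : R) : 0 < x -> ln x <= x - 1.
Proof. by move=> x0; have := @le_ln1Dx R (x - 1); rewrite (addrC 1) subrK; apply; lra. Qed.

Lemma ln_leS k : (0 < k)%N -> k%:R * (ln k.+1%:R - ln k%:R) <= 1 :> R.
Proof.
move=> k0; have K0 : 0 < k%:R :> R by rewrite ltr0n.
rewrite -ln_div ?posrE ?ltr0n // mulrC -ler_pdivlMr // mul1r.
apply: le_trans (ln_le_sub1 _) _; first by rewrite divr_gt0 ?ltr0n.
by rewrite -natr1 mulrDl divff ?gt_eqF // mul1r addrC addKr.
Qed.

(** The potential (A + B (ln x + 1))/x dominates the last term of [avg] and drops by at least (A + B
    ln x)/(x(x+1)) from x to x + 1, because x (ln (x+1) - ln x) <= 1. For k <= N, monotonicity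
    replaces k by N. *)
Lemma avg_tail (f : nat -> R) (A B : R) N k : 0 <= B -> (0 < N)%N -> (0 < k)%N ->
  (forall x, (0 < x)%N -> f x <= f x.+1) ->
  (forall x, (N <= x)%N -> f x <= A + B * ln x%:R) ->
  avg f k <= \sum_(1 <= x < N) f x / (x%:R * x.+1%:R) +
             (A + B * (ln N%:R + 1)) / N%:R.
Proof.
move=> B0 N0 k0 fm fN.
pose T x := (A + B * (ln x%:R + 1)) / x%:R.
have main m : (N <= m)%N -> \sum_(1 <= x < m) f x / (x%:R * x.+1%:R) + T m <=
    \sum_(1 <= x < N) f x / (x%:R * x.+1%:R) + T N.
  elim: m => [|m IH]; first by move: N0; case: (N).
  rewrite leq_eqVlt => /orP[/eqP -> //|Nm]; apply: le_trans (IH Nm).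
  have m0 : (0 < m)%N := leq_trans N0 Nm.
  rewrite big_nat_recr //= -addrA lerD2l.
  have M0 : 0 < m%:R :> R by rewrite ltr0n.
  have M1 : 0 < m.+1%:R :> R by rewrite ltr0n.
  have MM : 0 < m%:R * m.+1%:R :> R by rewrite mulr_gt0.
  rewrite -(ler_pM2r MM) mulrDl divfK ?gt_eqF // /T.
  have -> : (A + B * (ln m.+1%:R + 1)) / m.+1%:R * (m%:R * m.+1%:R) =
     (A + B * (ln m.+1%:R + 1)) * m%:R by field; rewrite addrC natr1 gt_eqF.
  have -> : (A + B * (ln m%:R + 1)) / m%:R * (m%:R * m.+1%:R) =
     (A + B * (ln m%:R + 1)) * m.+1%:R by field; rewrite gt_eqF.
  have := ler_wpM2l B0 (ln_leS m0); have := fN m Nm.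
  rewrite -[m.+1%:R in X in _ -> _ -> _ <= X]natr1; set l := ln m%:R; set l' := ln _.
  nra.
have [kN|Nk] := leqP k N.
  apply: (le_trans (avg_mono fm (m := N) _)); first by rewrite k0.
  by rewrite /avg lerD2l ler_wpM2r ?invr_ge0 // (le_trans (fN N _)) // mulrDr mulr1; lra.
apply: le_trans (main k (ltnW Nk)); rewrite /avg lerD2l ler_wpM2r ?invr_ge0 //.
by rewrite (le_trans (fN k (ltnW Nk))) // mulrDr mulr1; lra.
Qed.

Lemma ln2_ge : 2 / 3 <= ln 2 :> R.
Proof.
have h : 2 <= ln (2 ^+ 3) :> R.
  rewrite -ler_expR lnK ?posrE ?exprn_gt0 //.
  have -> : expR 2 = expR 1 ^+ 2 :> R by rewrite -expRM_natl mulr1.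
  have := expR1_le R; have := expR_gt0 (1 : R); nra.
by move: h; rewrite lnXn // -mulr_natl; lra.
Qed.

Lemma ln3_ge : 1 <= ln 3 :> R.
Proof. by rewrite -ler_expR lnK ?posrE //; have := expR1_le R; lra. Qed.

(** The comparison with ln 6 in [avg_euler_factor_log], cleared of the denominator 12. It follows
    from 40 <= 81 and ln 3 >= 1. *)
Lemma ln_numeric : 3 * ln 2 + ln 5 + 6 <= 10 * ln 3 :> R.
Proof.
have h3 := ln3_ge.
suff : 3 * ln 2 + ln 5 <= 4 * ln 3 :> R by lra.
have -> : 3 * ln 2 + ln 5 = ln 40 :> R.
  have -> : 40 = 2 ^+ 3 * 5 :> R by ring.
  by rewrite lnM ?posrE ?exprn_gt0 // lnXn // (mulr_natl (ln 2) 3).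
have -> : 4 * ln 3 = ln (3 ^+ 4) :> R by rewrite lnXn // (mulr_natl (ln 3) 4).
by rewrite ler_ln ?posrE ?exprn_gt0 //; lra.
Qed.

End RealLemmas.

(** * Euler factors of polynomials of bounded degree *)

Section EulerFactorBound.
Variables (F : finFieldType) (R : realType).
Implicit Types (p m : {poly F}) (L : seq {poly F}).
Local Notation q := (#|F|%:R : R).
Local Notation eg := (expR (euler_gamma R)).
Local Notation Q := (q / (q - 1)).

Lemma q_ge2 : 2 <= q.
Proof. by rewrite ler_nat qgt1. Qed.

Lemma Q_gt0 : 0 < Q.
Proof. by have := q_ge2 => h; rewrite divr_gt0 //; lra. Qed.

Lemma lnQ_le : ln Q <= (q - 1)^-1.
Proof.
apply: le_trans (ln_le_sub1 Q_gt0) _; have h := q_ge2.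
by rewrite le_eqVlt; apply/orP; left; apply/eqP; field; lra.
Qed.

Lemma lnQ_ge : q^-1 <= ln Q.
Proof.
have h := q_ge2; have q0 : 0 < q by lra.
rewrite -ler_expR lnK ?posrE ?Q_gt0 // ler_pdivlMr; last by lra.
have := expR_ge1Dx (- q^-1); rewrite expRN -(ler_pM2r (expR_gt0 q^-1)) mulVf ?gt_eqF ?expR_gt0 //.
rewrite -(ler_pM2r q0) mul1r; apply: le_trans.
by rewrite le_eqVlt; apply/orP; left; apply/eqP; field; lra.
Qed.

(* The values of prime_wt and degcap are chosen so that degcap d * (prime_wt d / d) is
   exactly 1/d for d >= 2; degcap d bounds d times the number of primes of degree d. *)
Definition prime_wt d : R := if d == 1%N then ln Q else (q ^+ d - 1)^-1.
(** The gain in the logarithm of an Euler factor per unit of degree spent on primes of degree d; it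
    decreases with d. *)
Definition slope d : R := prime_wt d / d%:R.

Lemma qX_gt1 d : (0 < d)%N -> 1 < q ^+ d.
Proof. by move=> d0; rewrite exprn_egt1 ?qR_gt1 // -lt0n. Qed.

Lemma prime_factor_le p : mirr p -> 1 + (pnorm R p - 1)^-1 <= expR (prime_wt (dg p)).
Proof.
move=> hp; rewrite /prime_wt /pnorm; case: eqP => [->|_]; last exact: expR_ge1Dx.
rewrite expr1 lnK ?posrE ?Q_gt0 // le_eqVlt; apply/orP; left; apply/eqP.
by have := q_ge2 => h; field; lra.
Qed.

Lemma prime_wt_ge0 d : (0 < d)%N -> 0 <= prime_wt d.
Proof.
move=> d0; rewrite /prime_wt; case: ifP => _.
  by apply: le_trans lnQ_ge; rewrite invr_ge0.
by rewrite invr_ge0 subr_ge0 ltW // qX_gt1.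
Qed.

Lemma slopeS d : (0 < d)%N -> slope d.+1 <= slope d.
Proof.
case: d => [//|[|d]] _; rewrite /slope /prime_wt /=.
  rewrite divr1; apply: le_trans lnQ_ge; have h := q_ge2.
  have h2 : 0 < q ^+ 2 - 1 by nra.
  rewrite -invfM lef_pV2 ?posrE; [nra|nra|lra].
have h := qX_gt1 (isT : 0 < d.+2)%N; have h' := qX_gt1 (isT : 0 < d.+3)%N.
rewrite -!invfM lef_pV2 ?posrE ?mulr_gt0 ?ltr0n ?subr_gt0 //.
apply: ler_pM; rewrite ?subr_ge0 ?(ltW h) ?ler_nat //.
by rewrite lerB // ler_eXn2l ?qR_gt1.
Qed.

Lemma slope_le d e : (0 < d)%N -> (d <= e)%N -> slope e <= slope d.
Proof.
move=> d0; elim: e => [|e IH]; first by rewrite leqn0 => /eqP e; move: d0; rewrite e.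
rewrite leq_eqVlt => /orP[/eqP <- //|de]; apply: le_trans (IH de).
by apply: slopeS; apply: leq_trans d0 de.
Qed.

Lemma slope_ge0 d : (0 < d)%N -> 0 <= slope d.
Proof. by move=> d0; rewrite divr_ge0 // prime_wt_ge0. Qed.

Definition degcap d : nat := if d == 1%N then #|F| else (#|F| ^ d - 1)%N.
(* degsum 0 = 1, not the empty sum: the extremal bound is sharp at degree 1. *)
Definition degsum k : nat := if k is 0 then 1%N else (\sum_(1 <= d < k.+1) degcap d)%N.

Lemma primepi_degcap d : (0 < d)%N -> (d * primepi F d <= degcap d)%N.
Proof.
case: d => [//|[|d]] _; rewrite /degcap /=; first by rewrite primepi1 mul1n.
by rewrite leq_subRL ?expn_gt0 ?(ltnW (qgt1 F)) // add1n primepi_lt.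
Qed.

Lemma degcapR d : (1 < d)%N -> (degcap d)%:R = q ^+ d - 1.
Proof.
move=> d1; rewrite /degcap gtn_eqF // natrB ?natrX //.
by rewrite expn_gt0 (ltnW (qgt1 F)).
Qed.

Lemma degsumS k : (0 < k)%N -> degsum k.+1 = (degsum k + degcap k.+1)%N.
Proof. by case: k => // k _; rewrite /degsum big_nat_recr. Qed.

Lemma degsum_ge k : (#|F| ^ k <= degsum k)%N.
Proof.
have q1 := ltnW (qgt1 F).
case: k => // k; elim: k => [|k IH]; first by rewrite /degsum big_nat1 /degcap expn1.
have a0 : (0 < degsum k.+1)%N by apply: leq_trans IH; rewrite expn_gt0 q1.
rewrite degsumS //; move: (degsum k.+1) a0 => a a0; rewrite /degcap /=.
by move: a0; move: (#|F| ^ k.+2)%N => b; clear; lia.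
Qed.

(** Each degree d > 1 gives 1/d. Degree 1 gives q ln Q, which is at most ln Q + 1 because (q - 1) ln
    Q <= 1. *)
Lemma sum_degcap_slope k : (0 < k)%N ->
  \sum_(1 <= d < k.+1) (degcap d)%:R * slope d <= ln Q + harm R k.
Proof.
have h := q_ge2.
case: k => // k _; elim: k => [|k IH].
  rewrite big_nat1 harm1 /slope /prime_wt /degcap /= divr1.
  have := lnQ_le; rewrite -(ler_pM2r (_ : 0 < q - 1)); last by lra.
  by rewrite mulVf; [nra|lra].
rewrite big_nat_recr //= harmS addrA lerD // degcapR // /slope /prime_wt /=.
by rewrite mulrA divff ?mul1r // gt_eqF // subr_gt0 qX_gt1.
Qed.

(** A fractional knapsack bound by duality. At the price sg = slope (k+1) per unit of degree, a
    prime of degree at most k has a nonnegative surplus [a d] and a larger one has none. Hence the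
    worst case takes all primes of degree at most k and spends the remaining degree at rate sg. *)
Lemma ln_euler_factor_le M m k : m != 0 ->
  euler_factor R (irrs F M) m <=
  Q * expR (harm R k + slope k.+1 * ((dg m)%:R - (degsum k)%:R)).
Proof.
move=> m0; set L := irrs F M; set sg := slope k.+1.
have sg0 : 0 <= sg by apply: slope_ge0.
have hL : {in L, forall p, mirr p} by move=> p /mirr_irrs.
rewrite -[X in X * _](lnK (_ : Q \in Num.pos)) ?posrE ?Q_gt0 // -expRD.
apply: (@le_trans _ _ (expR (\sum_(p <- L | p %| m) (dg p)%:R * slope (dg p)))).
  rewrite expR_sum /euler_factor big_seq_cond [leRHS]big_seq_cond; apply: ler_prod => p /andP[/hL hp _].
  rewrite addr_ge0 ?invr_ge0 ?subr_ge0 ?(ltW (pnorm_gt1 R hp)) //=.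
  rewrite /slope mulrC divfK; first exact: prime_factor_le.
  by rewrite pnatr_eq0 -lt0n dg_gt0.
rewrite ler_expR.
pose a d : R := d%:R * (slope d - sg).
have a_ge0 d : (0 < d <= k)%N -> 0 <= a d.
  move=> /andP[d0 dk]; rewrite mulr_ge0 // subr_ge0 slope_le //.
  by rewrite ltnW.
have step1 : \sum_(p <- L | p %| m) (dg p)%:R * slope (dg p) <=
    \sum_(p <- L) (if (dg p <= k)%N then a (dg p) else 0) + sg * (dg m)%:R.
  apply: (@le_trans _ _ (\sum_(p <- L | p %| m) a (dg p) + sg * (\sum_(p <- L | (p %| m)%R) dg p)%N%:R)).
    rewrite natr_sum mulr_sumr -big_split /=; apply: ler_sum => p _.
    by rewrite /a le_eqVlt; apply/orP; left; apply/eqP; ring.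
  apply: lerD; last by rewrite ler_wpM2l // ler_nat sum_dg_dvd // uniq_irrs.
  rewrite big_mkcond big_seq [leRHS]big_seq; apply: ler_sum => p /hL hp.
  have d0 := dg_gt0 hp.
  case: ifP => _; case: leqP => dk //; last by rewrite a_ge0 // d0.
  by rewrite mulr_ge0_le0 // subr_le0 slope_le.
apply: le_trans step1 _.
have step2 : \sum_(p <- L) (if (dg p <= k)%N then a (dg p) else 0) <=
   \sum_(1 <= d < k.+1) (degcap d)%:R * (slope d - sg).
  rewrite big_irrs.
  apply: (@le_trans _ _ (\sum_(1 <= d < M.+1 | (d < k.+1)%N) (degcap d)%:R * (slope d - sg))).
    rewrite [leRHS]big_mkcond; apply: ler_sum_nat => d /andP[d0 _].
    rewrite (@sum_irr_const _ _ _ _ (if (d <= k)%N then a d else 0)); last by move=> p /dg_irr ->.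
    rewrite ltnS; case: leqP => dk; last by rewrite mul0rn.
    have -> : a d *+ primepi F d = (d * primepi F d)%:R * (slope d - sg).
      by rewrite -[LHS]mulr_natr natrM /a mulrAC.
    by rewrite ler_wpM2r ?subr_ge0 ?slope_le ?leqW // ler_nat primepi_degcap.
  pose N := maxn M.+1 k.+1.
  rewrite (big_nat_widen 1 k.+1 N) ?leq_maxr // (big_nat_widen 1 M.+1 N) ?leq_maxl //.
  rewrite big_mkcond [leRHS]big_mkcond; apply: ler_sum_nat => d /andP[d0 _] /=.
  case: (ltnP d k.+1) => dk /=; last by rewrite ?andbF.
  case: ifP => // _; rewrite mulr_ge0 // subr_ge0 slope_le //.
  by rewrite ltnW.
apply: le_trans (lerD step2 (lexx _)) _.
(* For k = 0 the unit [degsum 0 = 1] is paid for by the leading Q, as slope 1 = ln Q. *)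
case: (posnP k) => [k0|k0].
  rewrite /sg k0 big_geq // harm0 /slope /prime_wt /= divr1 -mulr_natl; lra.
rewrite (eq_bigr _ (fun d _ => mulrBr _ _ _)) sumrB -mulr_suml -natr_sum.
have -> : (\sum_(1 <= d < k.+1) degcap d)%N = degsum k by case: (k) k0.
have := sum_degcap_slope k0; rewrite mulrBr; set A := \sum_(_ <= _ < _) _; move=> h.
by rewrite [_%:R * sg]mulrC; lra.
Qed.

(** Filling the range between consecutive [degsum] gains at most one step of the harmonic sum, so
    both ends of the chord are governed by [harm]. *)
Lemma slope_degcap k : slope k.+1 * ((degsum k.+1)%:R - (degsum k)%:R) <= k.+1%:R^-1.
Proof.
case: k => [|k].
  rewrite /slope /prime_wt /degsum big_nat1 /degcap /= !divr1 invr1.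
  have h := q_ge2; have := lnQ_le; rewrite -(ler_pM2r (_ : 0 < q - 1)); last by lra.
  by rewrite mulVf; [|lra].
rewrite (degsumS (ltn0Sn k)) natrD addrAC subrr add0r degcapR // /slope /prime_wt /= mulrAC mulVf ?mul1r //.
by rewrite gt_eqF // subr_gt0 qX_gt1.
Qed.

(* The exponential is convex in D between consecutive values of degsum, so it lies
   below its chord, whose endpoints are controlled by expR_harm_le. *)
Lemma euler_factor_chord M m k (D t : R) : m != 0 -> (dg m)%:R <= D -> 0 <= t <= 1 ->
  D = (1 - t) * (degsum k)%:R + t * (degsum k.+1)%:R ->
  euler_factor R (irrs F M) m <= Q * (1 + eg * (k%:R + t)).
Proof.
move=> m0 mD t01 eD; apply: le_trans (ln_euler_factor_le M k m0) _.
rewrite ler_pM2l ?Q_gt0 //.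
have [t0 t1] : 0 <= t /\ t <= 1 by case/andP: t01.
apply: (@le_trans _ _ (expR ((1 - t) * harm R k + t * harm R k.+1))).
  rewrite ler_expR harmS.
  have : slope k.+1 * ((dg m)%:R - (degsum k)%:R) <= t * k.+1%:R^-1.
    apply: (@le_trans _ _ (slope k.+1 * (t * ((degsum k.+1)%:R - (degsum k)%:R)))).
      by rewrite ler_wpM2l ?slope_ge0 //; move: mD; rewrite eD; lra.
    by rewrite mulrCA ler_wpM2l // slope_degcap.
  move: (slope _ * _) (k.+1%:R^-1) (harm R k) => x y z xy.
  suff -> : (1 - t) * z + t * (z + y) = z + t * y by rewrite lerD2l.
  by ring.
apply: le_trans (expR_convex _ _ t01) _.
have h0 := expR_harm_le R k; have h1 := expR_harm_le R k.+1.
rewrite -[in X in _ <= _ + _ * X]natr1 in h1.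
have t1' : 0 <= 1 - t by lra.
apply: le_trans (lerD (ler_wpM2l t1' h0) (ler_wpM2l t0 h1)) _.
by rewrite le_eqVlt; apply/orP; left; apply/eqP; ring.
Qed.

Lemma lnq_gt0 : 0 < ln q.
Proof. by rewrite ln_gt0 // qR_gt1. Qed.

Lemma degsum_lt k : (degsum k < degsum k.+1)%N.
Proof.
case: k => [|k]; first by rewrite /degsum big_nat1 /degcap qgt1.
rewrite (degsumS (ltn0Sn k)) -addn1 leq_add2l /degcap /= subn_gt0.
by rewrite -[X in (X < _)%N](expn0 #|F|) ltn_exp2l // qgt1.
Qed.

(** Choose k with degsum k <= D < degsum (k+1). As q^j <= degsum j, concavity of ln on the same
    chord gives k + t <= log_q D. *)
Lemma euler_factor_log M m D : m != 0 -> (dg m <= D)%N -> (0 < D)%N ->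
  euler_factor R (irrs F M) m <= Q * (1 + eg * (ln D%:R / ln q)).
Proof.
move=> m0 mD D0.
have ex : exists k, (D < degsum k)%N.
  exists D; apply: leq_trans (degsum_ge D); exact: ltn_expl (qgt1 F).
case: (ex_minnP ex) => -[|k]; first by rewrite /degsum ltnS leqNgt D0.
move=> Dk kmin.
have kD : (degsum k <= D)%N by rewrite leqNgt; apply/negP => /kmin; rewrite ltnn.
set a : R := (degsum k)%:R; set b : R := (degsum k.+1)%:R.
have ab : a < b by rewrite ltr_nat degsum_lt.
have aD : a <= D%:R by rewrite ler_nat.
have Db : D%:R <= b by rewrite ler_nat ltnW.
have ba : b - a != 0 by rewrite subr_eq0 gt_eqF.
pose t := (D%:R - a) / (b - a).
have t01 : 0 <= t <= 1.
  rewrite /t divr_ge0 ?subr_ge0 ?(ltW ab) //= ler_pdivrMr ?subr_gt0 // mul1r.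
  by rewrite lerB.
have eD : D%:R = (1 - t) * a + t * b.
  by rewrite /t; field.
have mDR : (dg m)%:R <= D%:R :> R by rewrite ler_nat.
apply: le_trans (euler_factor_chord M m0 mDR t01 eD) _.
rewrite ler_pM2l ?Q_gt0 // lerD2l ler_pM2l ?expR_gt0 //.
have a0 : 0 < a by rewrite ltr0n (leq_trans _ (degsum_ge k)) // expn_gt0 (ltnW (qgt1 F)).
have b0 : 0 < b by apply: lt_trans ab.
rewrite ler_pdivlMr ?lnq_gt0 // eD; apply: le_trans (ln_concave t01 a0 b0).
have [t0 t1] : 0 <= t /\ t <= 1 by case/andP: t01.
have lnX j : j%:R * ln q <= ln (degsum j)%:R.
  rewrite mulr_natl -lnXn ?qR_gt0 // ler_ln ?posrE ?exprn_gt0 ?qR_gt0 //.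
    by rewrite -natrX ler_nat degsum_ge.
  by rewrite ltr0n (leq_trans _ (degsum_ge j)) // expn_gt0 (ltnW (qgt1 F)).
have t1' : 0 <= 1 - t by lra.
apply: le_trans (lerD (ler_wpM2l t1' (lnX k)) (ler_wpM2l t0 (lnX k.+1))).
by rewrite -natr1 le_eqVlt; apply/orP; left; apply/eqP; ring.
Qed.

(** The chord for k = 0, from degree 1 to degree q; (D - 1)/(q - 1) <= D/q since D <= q. *)
Lemma euler_factor_lin M m (D : R) : m != 0 -> (dg m)%:R <= D -> 1 <= D <= q ->
  euler_factor R (irrs F M) m <= Q * (1 + eg * (D / q)).
Proof.
move=> m0 mD /andP[D1 Dq]; have h := q_ge2.
pose t := (D - 1) / (q - 1).
have t01 : 0 <= t <= 1.
  by rewrite /t divr_ge0 ?ler_pdivrMr ?mul1r //=; lra.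
have eD : D = (1 - t) * (degsum 0)%:R + t * (degsum 1)%:R.
  by rewrite /degsum big_nat1 /degcap /= /t; field; lra.
apply: le_trans (euler_factor_chord M m0 mD t01 eD) _.
rewrite ler_pM2l ?Q_gt0 // lerD2l ler_pM2l ?expR_gt0 // add0r.
rewrite /t ler_pdivrMr; last by lra.
rewrite mulrAC ler_pdivlMr; last by lra.
by nra.
Qed.

End EulerFactorBound.

(** * The averaged Euler factor in terms of delta and q *)

Lemma bin2_le x : ('C(x, 2) * 2 <= x * x.-1)%N.
Proof. by rewrite bin2 muln2 -[leqRHS]odd_double_half leq_addl. Qed.

Section AverageBound.
Variables (F : finFieldType) (R : realType) (g : {poly F}) (M : nat).
Hypothesis g1 : (0 < dg g)%N.
Local Notation q := (#|F|%:R : R).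
Local Notation eg := (expR (euler_gamma R)).
Local Notation Q := (q / (q - 1)).
Local Notation delta := ((dg g)%:R : R).

Let f x : R := euler_factor R (irrs F M) (gprod g x).
Let dx x : nat := (2 + 'C(x, 2))%N.

Let delta1 : 1 <= delta.
Proof. by rewrite ler1n. Qed.

Let f_mono x : (0 < x)%N -> f x <= f x.+1.
Proof.
move=> x0; apply: euler_factor_le => [p /mirr_irrs //|p _ /dvdp_trans]; apply.
exact: gprod_dvd.
Qed.

Let C := Q * eg / ln q.

Let C_ge0 : 0 <= C.
Proof.
have h1 := ltW (lnq_gt0 F R); have h2 := ltW (Q_gt0 F R).
by apply: divr_ge0 => //; apply: mulr_ge0 => //; apply: expR_ge0.
Qed.

Let f_log x (y : R) : (0 < x)%N -> (dx x)%:R <= y ->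
  f x <= Q + C * (ln delta + ln y).
Proof.
move=> x0 xy.
have d0 : 0 < (dx x)%:R :> R by rewrite ltr0n.
have y0 : 0 < y := lt_le_trans d0 xy.
have e0 : 0 < delta by apply: lt_le_trans delta1.
have h : (dg (gprod g x) <= dg g * dx x)%N by rewrite dg_gprod.
have p0 : (0 < dg g * dx x)%N by rewrite muln_gt0 g1.
apply: le_trans (euler_factor_log R M (gprod_neq0 g1 x0) h p0) _.
have -> : Q * (1 + eg * (ln (dg g * dx x)%N%:R / ln q)) = Q + C * ln (dg g * dx x)%N%:R.
  by rewrite /C; ring.
rewrite natrM lnM ?posrE // lerD2l ler_wpM2l //.
by rewrite lerD2l ler_ln ?posrE.
Qed.

Let dx_le x : (4 <= x)%N -> (dx x)%:R <= x%:R ^+ 2 / 2 :> R.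
Proof.
move=> x4; rewrite ler_pdivlMr // -natrX -natrM ler_nat /dx.
have := bin2_le x; move: 'C(x, 2) => c.
by case: x x4 => // x x4; rewrite /= expnS expn1; nia.
Qed.

(** The degrees at x = 1, 2, 3 are 2, 3, 5 times delta, with weights 1/2, 1/6, 1/12. From x = 4 on,
    2 + C(x,2) <= x^2/2 and [avg_tail] applies. *)
Lemma avg_euler_factor_log k : (0 < k)%N ->
  avg f k <= Q * (1 + eg * (ln (6 * delta) / ln q)).
Proof.
move=> k0; have B0 : 0 <= 2 * C by rewrite mulr_ge0.
have tail x : (4 <= x)%N -> f x <= (Q + C * (ln delta - ln 2)) + 2 * C * ln x%:R.
  move=> x4; have x0 : (0 < x)%N by apply: leq_trans x4.
  apply: le_trans (f_log x0 (dx_le x4)) _.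
  rewrite ln_div ?posrE ?exprn_gt0 ?ltr0n // lnXn ?ltr0n //.
  by rewrite le_eqVlt; apply/orP; left; apply/eqP; rewrite -(mulr_natl (ln _) 2); ring.
apply: le_trans (avg_tail B0 (isT : (0 < 4)%N) k0 f_mono tail) _.
rewrite big_ltn // big_ltn // big_ltn // big_geq // addr0.
have f1 := @f_log 1 2 isT (lexx _); have f2 := @f_log 2 3 isT (lexx _).
have f3 := @f_log 3 5 isT (lexx _).
have ln4 : ln 4 = 2 * ln 2 :> R.
  by rewrite (_ : 4 = 2 ^+ 2) ?lnXn ?(mulr_natl (ln 2) 2) // expr2 -natrM.
have ln6 : ln (6 * delta) = ln 2 + ln 3 + ln delta.
  rewrite lnM ?posrE //; last by apply: lt_le_trans delta1.
  by rewrite (_ : 6 = 2 * 3) ?lnM ?posrE // -natrM.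
have -> : Q * (1 + eg * (ln (6 * delta) / ln q)) = Q + C * (ln 2 + ln 3 + ln delta).
  by rewrite ln6 /C; ring.
have num := ler_wpM2l C_ge0 (ln_numeric R).
rewrite ln4; move: f1 f2 f3 num.
move: (f 1) (f 2) (f 3) (ln 2) (ln 3) (ln 5) (ln delta) Q C => a1 a2 a3 l2 l3 l5 l Q' C'.
nra.
Qed.

Let s := Num.sqrt (delta / q).

Let s_sq : s ^+ 2 = delta / q.
Proof. by rewrite sqr_sqrtr // divr_ge0 // ltW // qR_gt0. Qed.

Let s_gt0 : 0 < s.
Proof. by rewrite sqrtr_gt0 divr_gt0 ?qR_gt0 // (lt_le_trans _ delta1). Qed.

Let delta_s : delta = s ^+ 2 * q.
Proof. by rewrite s_sq divfK // gt_eqF // qR_gt0. Qed.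

(** With delta = s^2 q the claim reads ln (6 s^2) <= (5 s - 1) ln q. As 5 s >= 1 and ln q >= 2/3, it
    suffices that ln (6 s^2) <= (10 s - 2)/3; here 6 is rounded up to (5/2)^2. *)
Lemma log_le_sqrt : 1 / 5 <= s -> ln (6 * delta) / ln q <= 5 * s.
Proof.
move=> s5; have l2 := ln2_ge R; have q0 := qR_gt0 F R.
rewrite ler_pdivrMr ?lnq_gt0 // delta_s mulrA lnM ?posrE ?mulr_gt0 ?exprn_gt0 //.
have lq : 2 / 3 <= ln q by apply: le_trans l2 _; rewrite ler_ln ?posrE ?q_ge2.
have r0 : 0 < 5 / 2 * s by rewrite mulr_gt0.
have h1 : ln (6 * s ^+ 2) <= 2 * ln (5 / 2 * s).
  rewrite (mulr_natl (ln _) 2) -lnXn // ler_ln ?posrE ?mulr_gt0 ?exprn_gt0 //.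
  by have := sqr_ge0 s; lra.
have h2 : ln (5 / 2 * s) <= 5 / 3 * s - 1 / 3.
  (* Splitting off 3/2 makes ln x <= x - 1 produce the slope 5/3 that is needed. *)
  have -> : 5 / 2 * s = 3 / 2 * (5 / 3 * s) by field.
  rewrite lnM ?posrE ?mulr_gt0 //.
  have a1 : ln (3 / 2 : R) <= 3 / 2 - 1 by apply: ln_le_sub1.
  have a2 : ln (5 / 3 * s) <= 5 / 3 * s - 1 by apply: ln_le_sub1; rewrite mulr_gt0.
  by lra.
have : (5 * s - 1) * (2 / 3) <= (5 * s - 1) * ln q by rewrite ler_wpM2l //; lra.
by lra.
Qed.

Lemma sum_inv_prod N : (0 < N)%N ->
  \sum_(1 <= x < N) (x%:R * x.+1%:R)^-1 = 1 - N%:R^-1 :> R.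
Proof.
case: N => // N _; elim: N => [|N IH]; first by rewrite big_geq // invr1 subrr.
rewrite big_nat_recr //= IH -[N.+2%:R]natr1.
have : N.+1%:R != 0 :> R by rewrite pnatr_eq0.
have : N.+1%:R + 1 != 0 :> R by rewrite natr1 pnatr_eq0.
by move: (N.+1%:R) => a h1 h2; field; rewrite h1 h2.
Qed.

(** Cut at N, about 1/s, where delta x^2 reaches q. Below the cut the linear bound applies and the
    degree cancels the weight 1/(x(x+1)), so these x cost at most Q e^gamma s in all. The
    logarithmic tail costs at most (15/4) Q e^gamma s, and 1 + 15/4 <= 5. *)
Lemma avg_euler_factor_sqrt k : (0 < k)%N -> s < 1 / 5 ->
  avg f k <= Q * (1 + eg * (5 * s)).
Proof.
move=> k0 s5; have q0 := qR_gt0 F R; have Q0 := Q_gt0 F R.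
have sV0 : 0 <= s^-1 by rewrite invr_ge0 ltW.
pose N := Num.truncn s^-1.
have /andP[N1 N2] := truncn_itv sV0; rewrite -/N in N1 N2.
have sV5 : 5 < s^-1 by rewrite -[5]invrK ltf_pV2 ?posrE ?invr_gt0 //; lra.
have N4 : (4 < N)%N by rewrite -ltnS -(ltr_nat R); apply: lt_trans sV5 N2.
have N0 : (0 < N)%N by apply: leq_trans N4.
have NR0 : 0 < N%:R :> R by rewrite ltr0n.
have sN1 : s * N%:R <= 1 by rewrite -ler_pdivlMl // mulr1.
have sN2 : 1 < s * (N%:R + 1) by rewrite natr1 -ltr_pdivrMl // mulr1.
have dN : delta * N%:R ^+ 2 <= q.
  rewrite delta_s mulrAC -exprMn -[leRHS]mul1r ler_wpM2r ?(ltW q0) //.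
  by rewrite exprn_ile1 // mulr_ge0 // ltW.
have q3 : 3 <= q.
  have : 5 <= N%:R :> R by rewrite (ler_nat R 5).
  by move: dN delta1; nra.
have lq1 : 1 <= ln q by apply: le_trans (ln3_ge R) _; rewrite ler_ln ?posrE.
have B0 : 0 <= 2 * C by rewrite mulr_ge0.
have tail x : (N <= x)%N -> f x <= (Q + C * ln delta) + 2 * C * ln x%:R.
  move=> Nx; have x4 : (4 <= x)%N by apply: leq_trans Nx; apply: ltnW.
  have x0 : (0 < x)%N by apply: leq_trans x4.
  have X0 : 0 < x%:R :> R by rewrite ltr0n.
  have dxx : (dx x)%:R <= x%:R ^+ 2 :> R.
    apply: le_trans (dx_le x4) _; rewrite ler_pdivrMr // ler_peMr ?sqr_ge0 //.
    by rewrite (ler_nat R 1).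
  apply: le_trans (f_log x0 dxx) _; rewrite lnXn //.
  by rewrite le_eqVlt; apply/orP; left; apply/eqP; rewrite -(mulr_natl (ln _) 2); ring.
apply: le_trans (avg_tail B0 N0 k0 f_mono tail) _.
have lin x : (1 <= x < N)%N ->
    f x / (x%:R * x.+1%:R) <= Q * (x%:R * x.+1%:R)^-1 + Q * eg * s ^+ 2.
  move=> /andP[x0 xN]; have X0 : 0 < x%:R * x.+1%:R :> R by rewrite mulr_gt0 ?ltr0n.
  have dxx : (dx x <= x * x.+1)%N.
    rewrite /dx; have := bin2_le x; move: 'C(x, 2) => c.
    case: (x) x0 => // y _ /=.
    have -> : (y.+1 * y.+2 = y.+1 * y + y.+1 * 2)%N by rewrite -mulnDr addn2.
    by move: (y.+1 * y)%N => m; clear; lia.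
  have h1 : (dg (gprod g x))%:R <= delta * (x%:R * x.+1%:R).
    by rewrite dg_gprod // -!natrM ler_nat leq_pmul2l.
  have h2 : 1 <= delta * (x%:R * x.+1%:R) <= q.
    apply/andP; split; first by rewrite -!natrM (ler_nat R 1) !muln_gt0 g1 x0.
    apply: le_trans dN; rewrite ler_wpM2l ?ler0n // -natrX -natrM ler_nat expnS expn1.
    by rewrite leq_mul // ltnW.
  have := euler_factor_lin M (gprod_neq0 g1 x0) h1 h2.
  rewrite -/(f x) => h; rewrite ler_pdivrMr //; apply: le_trans h _.
  rewrite mulrDl divfK ?gt_eqF // mulrDr mulr1 lerD2l s_sq.
  by rewrite le_eqVlt; apply/orP; left; apply/eqP; ring.
have := ler_sum_nat lin; rewrite big_split /= -mulr_sumr sum_inv_prod // sumr_const_nat.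
rewrite -(mulr_natr (Q * eg * _)) natrB // => hs.
apply: le_trans (lerD hs (lexx _)) _.
have CE : C * ln q = Q * eg by rewrite /C divfK // gt_eqF // lnq_gt0.
(* By [dN], ln (delta N^2) <= ln q, and 2 <= 2 ln q by [lq1]; the resulting 3 ln q cancels the
   denominator of [C]. *)
have t1 : (Q + C * ln delta + 2 * C * (ln N%:R + 1)) / N%:R <= Q / N%:R + 3 * (Q * eg) / N%:R.
  rewrite -mulrDl ler_pM2r ?invr_gt0 // -!addrA lerD2l.
  have -> : C * ln delta + 2 * C * (ln N%:R + 1) = C * (ln (delta * N%:R ^+ 2) + 2).
    rewrite lnM ?posrE ?exprn_gt0 ?ltr0n // lnXn // -(mulr_natl (ln _) 2); ring.
  have h1 : ln (delta * N%:R ^+ 2) <= ln q.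
    by rewrite ler_ln ?posrE // mulr_gt0 ?exprn_gt0 ?ltr0n.
  have : C * (ln (delta * N%:R ^+ 2) + 2) <= C * (3 * ln q) by rewrite ler_wpM2l //; lra.
  by rewrite [C * (3 * _)]mulrCA CE.
apply: le_trans (lerD (lexx _) t1) _.
(* 1 < s (N + 1) <= (5/4) s N, as N > 4. *)
have iN : N%:R^-1 <= 5 / 4 * s.
  rewrite -[leLHS]mul1r ler_pdivrMr //.
  by nra.
have sN : s ^+ 2 * (N%:R - 1) <= s.
  rewrite expr2 -mulrA -[leRHS]mulr1 ler_pM2l //; lra.
have QE : 0 <= Q * eg by rewrite mulr_ge0 ?expR_ge0 // ltW.
have m0 := mulr_ge0 QE (ltW s_gt0); have m1 := ler_wpM2l QE sN; have m2 := ler_wpM2l QE iN.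
have -> : Q * (1 + eg * (5 * s)) = Q + Q * eg * (5 * s) by ring.
move: m0 m1 m2; move: (Q * eg) => E; move: Q (N%:R^-1 : R) (N%:R : R) s => Q' W N' s'.
by move=> m0 m1 m2; lra.
Qed.

Lemma avg_euler_factor_le k : (0 < k)%N ->
  avg f k <= Q * (1 + eg * Num.min (5 * Num.sqrt (delta / q)) (ln (6 * delta) / ln q)).
Proof.
move=> k0; rewrite -/s minEle; case: ifP => // _; last exact: avg_euler_factor_log.
have [s5|s5] := ltP s (1 / 5); first exact: avg_euler_factor_sqrt.
apply: le_trans (avg_euler_factor_log k0) _.
by rewrite ler_pM2l ?Q_gt0 // lerD2l ler_pM2l ?expR_gt0 // log_le_sqrt.
Qed.

Lemma sum_euler_factor_gpow k :
  \sum_(1 <= j < k.+1) euler_factor R (irrs F M) (gpow g j) <=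
  k%:R * (Q * (1 + eg * Num.min (5 * Num.sqrt (delta / q)) (ln (6 * delta) / ln q))).
Proof.
case: k => [|k]; first by rewrite big_geq // mul0r.
have h : {in [::], forall p : {poly F}, irreducible_poly p} by [].
have := romanoff_avg R g (isT : (0 < k.+1)%N) h (@mirr_irrs F M).
under eq_bigr do rewrite mul1r; move/le_trans; apply.
rewrite ler_wpM2l //; apply: le_trans (avg_euler_factor_le (isT : (0 < k.+1)%N)).
by apply: avg_le => // x _; rewrite mul1r.
Qed.

End AverageBound.

(** * Representations as irreducible plus power *)

Section Representations.
Variables (F : finFieldType) (n : nat) (g : {poly F}).
Hypotheses (g1 : (0 < dg g)%N) (n0 : (0 < n)%N).
Implicit Types (p h b : {poly F}).
Local Notation X := (F * 'rV[F]_n)%type.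

Definition topair p : X := (p`_n, poly_rV (p - p`_n *: 'X^n)).

Lemma hpoly_topair p : (size p <= n.+1)%N -> hpoly (topair p) = p.
Proof.
move=> sp; rewrite /hpoly /= poly_rV_K; first by rewrite addrC subrK.
apply/leq_sizeP => j; rewrite leq_eqVlt => /orP[/eqP <-|nj].
  by rewrite coefB coefZ coefXn eqxx mulr1 subrr.
rewrite coefB coefZ coefXn gtn_eqF // mulr0 subr0.
by apply: (leq_sizeP _ _ sp).
Qed.

Lemma hpoly_inj : injective (@hpoly F n).
Proof.
move=> [c v] [d w]; rewrite /hpoly /= => e.
have ec : c = d.
  have := congr1 (fun p => p`_n) e; rewrite /= !coefD !coefZ !coefXn eqxx !mulr1.
  by rewrite !(nth_default _ (size_rVpoly _)) !addr0.
by move: e; rewrite ec => /addrI/(can_inj rVpolyK) ->.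
Qed.

Definition shift b (x : X) : X := (x.1, x.2 + poly_rV b).

Lemma hpoly_shift b x : (size b <= n)%N -> hpoly (shift b x) = hpoly x + b.
Proof. by move=> sb; rewrite /hpoly /= linearD /= poly_rV_K // addrA. Qed.

Lemma shift_inj b : injective (shift b).
Proof. by move=> [c v] [d w] [-> /addIr ->]. Qed.

Lemma mem_irrset x : (x \in irrset F n) = (x.1 != 0) && irreducibleb (hpoly x).
Proof. by rewrite inE. Qed.

Lemma size_poly_of_coefs (c : {ffun 'I_n.+1 -> F}) : (size (poly_of_coefs c) <= n.+1)%N.
Proof. exact: size_poly. Qed.

Lemma poly_of_coefs_inj : injective (@poly_of_coefs F n).
Proof.
move=> c d e; apply/ffunP => i; have := congr1 (fun p : {poly F} => p`_i) e.
by rewrite /= !coef_poly ltn_ord inord_val.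
Qed.

Lemma poly_of_coefsK p : (size p <= n.+1)%N ->
  poly_of_coefs [ffun i : 'I_n.+1 => p`_i] = p.
Proof.
move=> sp; apply/polyP => i; rewrite coef_poly; case: ltnP => ni.
  by rewrite ffunE inordK.
by rewrite nth_default // (leq_trans sp).
Qed.

(** Each pair of an exponent k <= n/delta and an irreducible h gives at most one f. *)
Lemma Rtilde_le : (Rtilde n g <= (n %/ dg g).+1 * #|irrset F n|)%N.
Proof.
have gn0 : g != 0 by apply: contraTneq g1 => ->; rewrite /dg size_poly0.
pose B k := [set c : {ffun 'I_n.+1 -> F} | topair (poly_of_coefs c - g ^+ k) \in irrset F n].
have sgk k : (k < (n %/ dg g).+1)%N -> (size (g ^+ k) <= n.+1)%N.
  rewrite ltnS leq_divRL // => h; rewrite (size_dg (expf_neq0 _ gn0)) dgX ltnS mulnC //.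
have sB (c : {ffun 'I_n.+1 -> F}) k : (k < (n %/ dg g).+1)%N -> (size (poly_of_coefs c - g ^+ k)%R <= n.+1)%N.
  move=> /sgk sk; apply: leq_trans (size_polyD _ _) _.
  by rewrite size_polyN geq_max size_poly_of_coefs.
have cB k : (k < (n %/ dg g).+1)%N -> (#|B k| <= #|irrset F n|)%N.
  move=> hk; rewrite -(card_in_imset (f := fun c => topair (poly_of_coefs c - g ^+ k))).
    by apply/subset_leq_card/fintype.subsetP => x /imsetP[c]; rewrite inE => h ->.
  move=> c d _ _ /(congr1 (@hpoly F n)).
  by rewrite !hpoly_topair ?sB // => /addIr/poly_of_coefs_inj.
apply: (@leq_trans (\sum_(0 <= k < (n %/ dg g).+1) #|B k|)); last first.
  apply: leq_trans (_ : \sum_(0 <= k < (n %/ dg g).+1) #|irrset F n| <= _)%N.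
    by rewrite big_nat [leqRHS]big_nat; apply: leq_sum => k /andP[_]; exact: cB.
  by rewrite sum_nat_const_nat subn0.
under eq_bigr do rewrite -sum1_card big_mkcond /=.
rewrite /Rtilde -sum1_card big_mkcond exchange_big; apply: leq_sum => c _ /=.
case: ifP => //; rewrite inE => /asboolP[sf [h [k [sh [ih ef]]]]].
have hk : (k < (n %/ dg g).+1)%N.
  (* If k delta > n, then f has degree k delta instead of n. *)
  rewrite ltnS leq_divRL // leqNgt; apply/negP => lt.
  have : size (poly_of_coefs c) = size (g ^+ k).
    rewrite ef addrC size_polyDl // sh (size_dg (expf_neq0 _ gn0)) dgX ltnS mulnC.
    by rewrite mulnC mulnC.
  rewrite sf (size_dg (expf_neq0 _ gn0)) dgX => -[e].
  by move: lt; rewrite e mulnC ltnn.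
rewrite (bigD1_seq k) ?iota_uniq ?mem_index_iota //= inE.
have -> : poly_of_coefs c - g ^+ k = h by rewrite ef addrK.
rewrite mem_irrset hpoly_topair ?sh //.
have -> : (topair h).1 != 0.
  by apply/size_hpoly; rewrite hpoly_topair ?sh.
by move/irreducibleP: ih => ->.
Qed.

(** The number ceil(n/delta) of k with k delta < n. The strict inequality ensures that translation
    by g^k preserves the coefficient of X^n, so each such k has equally many representations. *)
Definition nrep := (n.-1 %/ dg g).+1.

Lemma size_gX k : (k < nrep)%N -> (size (g ^+ k) <= n)%N.
Proof.
have gn0 : g != 0 by apply: contraTneq g1 => ->; rewrite /dg size_poly0.
rewrite /nrep ltnS leq_divRL // (size_dg (expf_neq0 _ gn0)) dgX mulnC.
by move: n0; clear; lia.
Qed.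

Definition rep k (x : X) : bool := shift (- g ^+ k) x \in irrset F n.

Lemma rep_Rtilde : (#|[set x : X | [exists k : 'I_nrep, rep k x]]| <= Rtilde n g)%N.
Proof.
pose tc (x : X) : {ffun 'I_n.+1 -> F} := [ffun i : 'I_n.+1 => (hpoly x)`_i].
have sx x : (size (@hpoly F n x) <= n.+1)%N.
  rewrite (leq_trans (size_polyD _ _)) // geq_max (leq_trans (size_scale_leq _ _)) ?size_polyXn //=.
  by rewrite (leq_trans (size_rVpoly _)).
have tcK x : poly_of_coefs (tc x) = hpoly x by rewrite poly_of_coefsK.
have tcI : injective tc.
  by move=> x y /(congr1 (@poly_of_coefs F n)); rewrite !tcK => /hpoly_inj.
rewrite -(card_imset _ tcI); apply/subset_leq_card/fintype.subsetP => c /imsetP[x].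
rewrite inE => /existsP[k hk] ->; rewrite inE; apply/asboolP.
have sk : (size (- g ^+ k) <= n)%N by rewrite size_polyN size_gX.
move: hk; rewrite /rep mem_irrset hpoly_shift // => /andP[x1 /irreducibleP ih].
rewrite /shifted_irr tcK; split; first exact/size_hpoly.
exists (hpoly x - g ^+ k), (val k); split; last by rewrite subrK.
by rewrite -hpoly_shift //; apply/size_hpoly.
Qed.

Lemma card_rep k : (k < nrep)%N -> #|[set x | rep k x]| = #|irrset F n|.
Proof.
move=> hk; rewrite -(card_imset _ (@shift_inj (- g ^+ k))); apply: eq_card => y.
apply/imsetP/idP => [[x]|yI]; first by rewrite inE => h ->.
have sk : (size (g ^+ k) <= n)%N := size_gX hk.
exists (shift (g ^+ k) y).
  by rewrite inE /rep /shift /= -addrA -linearD /= subrr linear0 addr0; case: (y) yI.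
by rewrite /shift /= -addrA -linearD /= subrr linear0 addr0; case: (y).
Qed.

(** Replacing x by x - g^k turns two representations of x into a pair of irreducibles with
    difference g^k - g^l. *)
Lemma card_rep2 k l : (k < nrep)%N -> (l < nrep)%N ->
  (#|[set x | rep k x && rep l x]| <=
   #|[set x in irrset F n | irreducibleb (hpoly x + (g ^+ k - g ^+ l)%R)]|)%N.
Proof.
move=> hk hl; rewrite -(card_imset _ (@shift_inj (- g ^+ k))).
have sk := size_gX hk; have sl := size_gX hl.
apply/subset_leq_card/fintype.subsetP => y /imsetP[x]; rewrite inE => /andP[h1 h2] ->.
rewrite inE; apply/andP; split; first exact: h1.
move: h2; rewrite /rep mem_irrset => /andP[_].
by rewrite !hpoly_shift ?size_polyN // addrA subrK.
Qed.

End Representations.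

(** * Cauchy-Schwarz and the second moment *)

Lemma sum_sqr_support (R : realFieldType) (T : finType) (r : T -> R) (S : {set T}) :
  (forall x, x \notin S -> r x = 0) ->
  (\sum_x r x) ^+ 2 <= #|S|%:R * \sum_x r x ^+ 2.
Proof.
move=> rS.
have sE (h : R -> R) : h 0 = 0 -> \sum_x h (r x) = \sum_(x in S) h (r x).
  move=> h0; rewrite [LHS](bigID (mem S)) /= [X in _ + X]big1 ?addr0 // => x /rS ->.
  by [].
rewrite (sE id) // (sE (fun y => y ^+ 2)) ?expr0n //.
set N : R := #|S|%:R; set A := \sum_(x in S) r x; set B := \sum_(x in S) _.
have [S0|S0] := posnP #|S|.
  by rewrite /A (cards0_eq S0) big_set0 expr0n /= mulr_ge0 // sumr_ge0 // => x _; rewrite sqr_ge0.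
have N0 : 0 < N by rewrite ltr0n.
have : 0 <= \sum_(x in S) (N * r x - A) ^+ 2 by apply: sumr_ge0 => x _; rewrite sqr_ge0.
have -> : \sum_(x in S) (N * r x - A) ^+ 2 = N * (N * B - A ^+ 2).
  rewrite (eq_bigr (fun x => N ^+ 2 * r x ^+ 2 + (- (2 * N * A)) * r x + A ^+ 2)); last first.
    by move=> x _; ring.
  rewrite !big_split /= -!mulr_sumr sumr_const -/A -/B -mulr_natl -/N; ring.
by rewrite pmulr_rge0 // subr_ge0.
Qed.

Section SecondMoment.
Variables (F : finFieldType) (R : realType) (n : nat) (g : {poly F}).
Hypotheses (g1 : (0 < dg g)%N) (n0 : (0 < n)%N).
Local Notation q := (#|F|%:R : R).
Local Notation eg := (expR (euler_gamma R)).
Local Notation Q := (q / (q - 1)).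
Local Notation delta := ((dg g)%:R : R).
Local Notation K := (nrep n g).
Local Notation P := (#|irrset F n|%:R : R).

Definition avgconst : R :=
  Q * (1 + eg * Num.min (5 * Num.sqrt (delta / q)) (ln (6 * delta) / ln q)).

Lemma avgconst_ge0 : 0 <= avgconst.
Proof.
have e1 : 1 <= delta by rewrite ler1n.
rewrite mulr_ge0 ?(ltW (Q_gt0 F R)) // addr_ge0 // mulr_ge0 ?expR_ge0 //.
rewrite le_min mulr_ge0 ?sqrtr_ge0 //= divr_ge0 ?(ltW (lnq_gt0 F R)) // ln_ge0 //.
by lra.
Qed.

Let c0 : R := (q - 1) * (8 * q ^+ n) / (n.+1 * n.+3)%:R.
Let Phi j : R := euler_factor R (irrs F n./2) (gpow g j).

Let c0_ge0 : 0 <= c0.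
Proof.
have h := q_ge2 F R.
rewrite /c0 divr_ge0 // mulr_ge0 ?subr_ge0 // ?mulr_ge0 ?exprn_ge0 //; lra.
Qed.

(** Passing from g^k - g^l to [gpow] can only enlarge the set of primes, and makes the bound depend
    on |k - l| alone. *)
Lemma card_rep2_le k l : (k < K)%N -> (l < K)%N -> k != l ->
  (#|[set x : F * 'rV[F]_n | rep g k x && rep g l x]|%:R : R) <=
  c0 * Phi (maxn k l - minn k l).
Proof.
move=> hk hl kl.
have sb : (size (g ^+ k - g ^+ l)%R <= n)%N.
  apply: leq_trans (size_polyD _ _) _.
  by rewrite size_polyN geq_max !size_gX.
have h1 : (#|[set x : F * 'rV[F]_n | rep g k x && rep g l x]|%:R : R) <=
    #|[set x in irrset F n | irreducibleb (hpoly x + (g ^+ k - g ^+ l))]|%:R.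
  by rewrite ler_nat card_rep2.
apply: le_trans h1 _.
have N0 : 0 < (n.+1 * n.+3)%:R :> R by rewrite ltr0n.
have := twin_count R sb n0; rewrite -ler_pdivlMr // => h; apply: le_trans h _.
rewrite mulrA mulrAC -/c0 ler_wpM2l //.
apply: euler_factor_le => [p /mirr_irrs //|p /mirr_irrs hp]; have ip := mirr_irr hp.
have main i j : (i < j)%N -> p %| g ^+ j - g ^+ i -> p %| gpow g (j - i).
  move=> ij; rewrite -{1}(subnKC (ltnW ij)) exprD -[X in _ - X]mulr1 -mulrBr.
  rewrite /gpow !irr_dvdM // => /orP[/(irr_dvdX ip) ->//|->]; by rewrite orbT.
case: (ltngtP k l) kl => // lt _.
  by rewrite -dvdpNr opprB; apply: main.
exact: main.
Qed.

Lemma sum_Phi k : (\sum_(1 <= j < k.+1) Phi j) <= k%:R * avgconst.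
Proof. exact: sum_euler_factor_gpow. Qed.

(** The diagonal gives P. Off it, the differences fill 1..k for l < k and 1..K-k-1 for l > k, so the
    two averages together cost K - 1 <= K terms. *)
Lemma row_sum k : (k < K)%N ->
  \sum_(0 <= l < K) (#|[set x : F * 'rV[F]_n | rep g k x && rep g l x]|%:R : R) <=
  P + c0 * (K%:R * avgconst).
Proof.
move=> hk; rewrite (big_cat_nat (n := k)) //=; last exact: ltnW.
rewrite [X in _ + X]big_ltn //.
have -> : #|[set x : F * 'rV[F]_n | rep g k x && rep g k x]|%:R = P.
  by rewrite -(card_rep g1 n0 hk); congr (_%:R); apply: eq_card => x; rewrite !inE andbb.
rewrite addrCA lerD2l.
have b1 : \sum_(0 <= l < k) (#|[set x : F * 'rV[F]_n | rep g k x && rep g l x]|%:R : R) <=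
    c0 * (k%:R * avgconst).
  apply: (@le_trans _ _ (c0 * \sum_(1 <= j < k.+1) Phi j)); last by rewrite ler_wpM2l // sum_Phi.
  rewrite big_add1 /= big_nat_rev /= add0n mulr_sumr; apply: ler_sum_nat => l /andP[_ lk].
  apply: le_trans (card_rep2_le hk _ _) _; first by move: lk hk; clear; lia.
    by move: lk; clear; lia.
  by rewrite (_ : (maxn _ _ - minn _ _ = l.+1)%N) //; move: lk; clear; lia.
have b2 : \sum_(k.+1 <= l < K) (#|[set x : F * 'rV[F]_n | rep g k x && rep g l x]|%:R : R) <=
    c0 * ((K - k.+1)%:R * avgconst).
  apply: (@le_trans _ _ (c0 * \sum_(1 <= j < (K - k.+1).+1) Phi j)); last by rewrite ler_wpM2l // sum_Phi.
  have E (G : nat -> R) : \sum_(k.+1 <= l < K) G l = \sum_(0 <= i < K - k.+1) G (i + k.+1)%N.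
    by rewrite -{1}(add0n k.+1) big_addn.
  rewrite E big_add1 /= mulr_sumr; apply: ler_sum_nat => l /andP[_ lk].
  apply: le_trans (card_rep2_le hk _ _) _; [by move: lk hk; clear; lia|by clear; lia|].
  by rewrite (_ : (maxn _ _ - minn _ _ = l.+1)%N) //; move: lk; clear; lia.
apply: le_trans (lerD b1 b2) _; rewrite -mulrDr -mulrDl -natrD ler_wpM2l //.
by rewrite ler_wpM2r ?avgconst_ge0 // ler_nat; move: hk; clear; lia.
Qed.

Lemma Rtilde_lower :
  (K%:R * P) ^+ 2 <= (Rtilde n g)%:R * (K%:R * (P + c0 * (K%:R * avgconst))).
Proof.
set S := [set x : F * 'rV[F]_n | [exists k : 'I_K, rep g k x]].
pose r (x : F * 'rV[F]_n) : R := \sum_(0 <= k < K) (rep g k x)%:R.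
have rS x : x \notin S -> r x = 0.
  rewrite inE negb_exists => /forallP h; rewrite /r big_mkord big1 // => k _.
  by rewrite (negPf (h k)).
have s1 : \sum_x r x = K%:R * P.
  rewrite exchange_big /= (eq_big_nat _ _ (F2 := fun=> P)).
    by rewrite sumr_const_nat subn0 mulr_natl.
  move=> k /andP[_ hk]; rewrite -(card_rep g1 n0 hk) -sum1_card natr_sum [RHS]big_mkcond.
  by apply: eq_bigr => x _; rewrite inE; case: rep.
have s2 : \sum_x r x ^+ 2 <= K%:R * (P + c0 * (K%:R * avgconst)).
  have -> : \sum_x r x ^+ 2 = \sum_(0 <= k < K) \sum_(0 <= l < K)
      (#|[set x : F * 'rV[F]_n | rep g k x && rep g l x]|%:R : R).
    under eq_bigr => x _.
      rewrite expr2 /r mulr_suml; under eq_bigr do rewrite mulr_sumr.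
      over.
    rewrite exchange_big /=; apply: eq_bigr => k _.
    rewrite exchange_big /=; apply: eq_bigr => l _.
    rewrite -sum1_card natr_sum [RHS]big_mkcond; apply: eq_bigr => x _.
    by rewrite inE; do 2 case: rep; rewrite ?mulr0 ?mul0r ?mulr1.
  apply: (@le_trans _ _ (\sum_(0 <= k < K) (P + c0 * (K%:R * avgconst)))).
    by apply: ler_sum_nat => k /andP[_ hk]; apply: row_sum.
  by rewrite sumr_const_nat subn0 [leRHS]mulr_natl.
rewrite -s1; apply: le_trans (sum_sqr_support rS) _.
apply: ler_pM => //; first by apply: sumr_ge0 => x _; rewrite sqr_ge0.
by rewrite ler_nat rep_Rtilde.
Qed.

End SecondMoment.

(** * Density of irreducibles and the final estimate *)

Section Main.
Variables (F : finFieldType) (R : realType) (n : nat).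
Hypothesis n0 : (0 < n)%N.
Local Notation q := (#|F|%:R : R).
Local Notation rho := ((n * primepi F n)%:R / q ^+ n : R).

Lemma rho_gt0 : 0 < rho.
Proof.
by rewrite divr_gt0 ?exprn_gt0 ?qR_gt0 // ltr0n muln_gt0 n0 primepi_gt0.
Qed.

Lemma rho_le1 : rho <= 1.
Proof.
rewrite ler_pdivrMr ?exprn_gt0 ?qR_gt0 // mul1r -natrX ler_nat.
exact: primepi_le.
Qed.

(** For n > 1 one has q^(n/2) >= 2, so the base on the left is nonnegative and [primepi_ge] can be
    squared. *)
Lemma rho_ge : (1 - 2 * q `^ (- (n%:R / 2))) ^+ 2 <= rho ^+ 2.
Proof.
have q2 := q_ge2 F R; have q0 := qR_gt0 F R.
rewrite powRN; set y := q `^ (n%:R / 2).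
have y0 : 0 < y by rewrite powR_gt0.
have yy : y ^+ 2 = q ^+ n.
  rewrite -powR_mulrn ?powR_ge0 // /y -powRrM divfK ?pnatr_eq0 //.
  by rewrite powR_mulrn // ltW.
have y1 : 1 <= y.
  rewrite -(ler_pXn2r (n := 2)) ?nnegrE ?(ltW y0) // expr1n yy exprn_ege1 //.
  by lra.
(* For n = 1, rho = 1, while the base may be negative (q = 2, 3); it still lies in [-1, 1]. *)
have [n1|n1] := leqP n 1.
  have -> : n = 1%N by move: n0 n1; clear; lia.
  rewrite primepi1 mul1n expr1 divff ?gt_eqF // expr1n.
  have : 0 < y^-1 by rewrite invr_gt0.
  have : y^-1 <= 1 by rewrite invf_le1.
  by nra.
have y2 : 2 <= y.
  rewrite -(ler_pXn2r (n := 2)) ?nnegrE ?(ltW y0) // yy.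
  apply: (@le_trans _ _ (q ^+ 2)); first by rewrite lerXn2r ?nnegrE ?(ltW q0).
  by rewrite ler_weXn2l //; lra.
have qm : (#|F| ^ n./2)%:R <= y :> R.
  rewrite -(ler_pXn2r (n := 2)) ?nnegrE ?(ltW y0) // yy -!natrX ler_nat -expnM.
  by rewrite leq_exp2l ?qgt1 //; lia.
have e0 : 0 <= 1 - 2 * y^-1 by rewrite subr_ge0 ler_pdivrMr ?mul1r.
rewrite lerXn2r ?nnegrE ?(ltW rho_gt0) //.
have h1 := leq_trans (primepi_ge F n1) (leq_add (leqnn _) (geom_le F n./2)).
move: h1; rewrite -(ler_nat R) natrX natrD -yy => h1.
rewrite ler_pdivlMr ?yy ?exprn_gt0 // -?yy.
have -> : (1 - 2 * y^-1) * y ^+ 2 = y ^+ 2 - 2 * y.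
  by field; rewrite gt_eqF.
have : (2 * #|F| ^ n./2)%:R <= 2 * y :> R by rewrite natrM ler_pM2l.
by lra.
Qed.

End Main.

Unset Implicit Arguments.

Theorem theorem2 (R : realType) (F : finFieldType) (g : {poly F}) (n : nat) :
  let q : R := (#|F|%:R) in
  let delta : R := ((size g).-1)%:R in
  (1 <= (size g).-1)%N -> (1 <= n)%N ->
  (1 + delta / n%:R) / delta >= rtilde R n g /\
  rtilde R n g >
    (1 - 2 * q `^ (- (n%:R / 2))) ^+ 2 * (1 + delta / n%:R)^-1 /
    (delta + 8 * (q / (q - 1)) *
       (1 + expR (euler_gamma R) *
            Num.min (5 * Num.sqrt (delta / q)) (ln (6 * delta) / ln q))).
Proof.
move=> q delta g1 n0; rewrite -/(dg g) in delta g1 *.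
have q2 : 2 <= q := q_ge2 F R.
have d0 : 0 < delta by rewrite ltr0n.
have N0 : 0 < n%:R :> R by rewrite ltr0n.
have qn0 : 0 < q ^+ n by rewrite exprn_gt0 //; lra.
pose rho : R := (n * primepi F n)%:R / q ^+ n.
pose Z : R := (q - 1) * q ^+ n.
have Z0 : 0 < Z by rewrite mulr_gt0 //; lra.
have PE : (#|irrset F n|%:R : R) = rho * Z / n%:R.
  rewrite card_irrset natrM /rho natrM /Z -subn1 natrB ?(ltnW (qgt1 F)) // -/q.
  by field; rewrite !gt_eqF.
have r0 : 0 < rho := rho_gt0 F R n0.
have r1 : rho <= 1 := rho_le1 F R n0.
rewrite /rtilde -/q -/Z; set RT : R := (Rtilde n g)%:R.
split.
  rewrite ler_pdivrMr //.
  have : RT <= ((n %/ dg g).+1 * #|irrset F n|)%N%:R by rewrite ler_nat Rtilde_le.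
  move/le_trans; apply; rewrite natrM PE.
  have k1 : (n %/ dg g).+1%:R <= n%:R / delta + 1.
    by rewrite -natr1 lerD2r ler_pdivlMr // -natrM ler_nat leq_trunc_div.
  apply: le_trans (ler_wpM2r _ k1) _.
    by apply: divr_ge0; [apply: mulr_ge0; exact: ltW|exact: ltW].
  have -> : (1 + delta / n%:R) / delta * Z = (n%:R / delta + 1) * (1 * Z / n%:R).
    by field; rewrite !gt_eqF.
  rewrite ler_wpM2l ?addr_ge0 ?divr_ge0 ?(ltW N0) ?(ltW d0) //.
  by rewrite ler_pM2r ?invr_gt0 // ler_pM2r.
have A0 := avgconst_ge0 R g1; have low := Rtilde_lower R g1 n0.
have rE := rho_ge F R n0; rewrite -/rho in rE.
rewrite -mulrA -[_ + 8 * _ * _]/(delta + 8 * (q / (q - 1)) * _).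
set A := avgconst R g in A0 low.
have -> : delta + 8 * (q / (q - 1)) * (1 + expR (euler_gamma R) *
   Num.min (5 * Num.sqrt (delta / q)) (ln (6 * delta) / ln q)) = delta + 8 * A.
  by rewrite /A /avgconst -!mulrA.
set E := _ ^+ 2 in rE *; have E0 : 0 <= E by apply: sqr_ge0.
set k : R := (nrep n g)%:R in low.
have k0 : 0 < k by rewrite ltr0n.
have kn : n%:R <= k * delta.
  rewrite -natrM ler_nat /nrep; have := divn_eq n.-1 (dg g).
  have := ltn_pmod n.-1 g1; move: (_ %/ _)%N (_ %% _)%N => a b; rewrite mulSn.
  by move: n0; clear; lia.
have RT0 : 0 <= RT by [].
have M0 : 0 < (n.+1 * n.+3)%:R :> R by rewrite ltr0n.
have c0 : (q - 1) * (8 * q ^+ n) / (n.+1 * n.+3)%:R <= 8 * Z / n%:R ^+ 2.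
  have -> : (q - 1) * (8 * q ^+ n) = 8 * Z by rewrite /Z; ring.
  apply: ler_wpM2l; first by apply: mulr_ge0 => //; apply: ltW.
  rewrite lef_pV2 ?posrE ?exprn_gt0 // -natrX ler_nat expnS expn1 leq_mul //.
  by apply: leqW; apply: leqW.
(* [Rtilde_lower] divided by (k Z/n)^2, using rho <= 1 in the diagonal term, (n+1)(n+3) >= n^2 in
   the twin term, and n/k <= delta. *)
have key : rho ^+ 2 <= RT / Z * (delta + 8 * A).
  have h1 : k * (rho * Z / n%:R) ^+ 2 <= RT * (Z / n%:R + 8 * Z / n%:R ^+ 2 * (k * A)).
    rewrite -(ler_pM2l k0); rewrite PE in low.
    have -> : k * (k * (rho * Z / n%:R) ^+ 2) = (k * (rho * Z / n%:R)) ^+ 2 by ring.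
    apply: le_trans low _; rewrite [leRHS]mulrCA ler_wpM2l // ler_pM2l //.
    apply: lerD; last by rewrite ler_wpM2r // mulr_ge0 // ltW.
    by rewrite ler_pM2r ?invr_gt0 // ler_piMl // ltW.
  have h2 : rho ^+ 2 <= RT / Z * (n%:R / k + 8 * A).
    have c : 0 < k * Z ^+ 2 / n%:R ^+ 2 by apply: divr_gt0; [apply: mulr_gt0 => //|]; apply: exprn_gt0.
    rewrite -(ler_pM2l c).
    have -> : k * Z ^+ 2 / n%:R ^+ 2 * rho ^+ 2 = k * (rho * Z / n%:R) ^+ 2.
      by field; rewrite gt_eqF.
    apply: le_trans h1 _; rewrite le_eqVlt; apply/orP; left; apply/eqP.
    by field; rewrite !gt_eqF.
  apply: le_trans h2 _; apply: ler_wpM2l; first by apply: divr_ge0 => //; apply: ltW.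
  rewrite lerD2r.
  by rewrite ler_pdivrMr // mulrC.
have D0 : 0 < delta + 8 * A by rewrite ltr_wpDr // mulr_ge0.
rewrite mulrA ltr_pdivrMr //; apply: lt_le_trans key.
(* The strict inequality comes from here, as rho is positive. *)
have t1 : (1 + delta / n%:R)^-1 < 1.
  by rewrite invf_lt1 ?ltrDl ?divr_gt0 // addr_gt0 // divr_gt0.
have t0 : 0 < (1 + delta / n%:R)^-1 by rewrite invr_gt0 addr_gt0 // divr_gt0.
apply: (@le_lt_trans _ _ (rho ^+ 2 * (1 + delta / n%:R)^-1)).
  by rewrite ler_pM2r.
by rewrite -[ltRHS]mulr1 ltr_pM2l // exprn_gt0.
Qed.
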